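(* Let $K \subset \mathbb{C}$ be a compact, non-polar and polynomially convex set. Let $(q_k)_{k>0}$ be a sequence of complex polynomials of degrees $n_k>0$ with $n_k\to\infty$, and let $(a_k)_k\subset\mathbb{C}$ be a sequence with $\log^+|a_k| = o(n_k)$ as $k\to\infty$. If $(q_k)_{k>0}$ centers on $K$ and is $K$-regular, then $(q_k-a_k)_k$ centers on $K$ and is $K$-regular.
   Context: $\log^+(w)=\max\{0,\log w\}$ for $w>0$ and $\log^+(0)=0$. A compact set $K\subset\mathbb{C}$ is polynomially convex if and only if $\Omega := \mathbb{C}\setminus K$ is connected; non-polar means of positive logarithmic capacity. Let $\omega$ be the equilibrium measure of $K$ with energy $I(\omega)=\iint \log|z-w|\,d\omega(z)\,d\omega(w)$. The Green's function of $\Omega$ with pole at $\infty$ is $g_\Omega(z) = \int \log|z-w|\,d\omega(w) - I(\omega)$. Write $\mathbb{D}(R)=\mathbb{D}(0,R)=\{z:|z|<R\}$. Let $(p_k)_{k>0}$ be a sequence of polynomials of degrees $d_k>0$ with $d_k\to\infty$. $K$-regularity: $(p_k)_{k>0}$ is $K$-regular if for some $R>0$ (which may be enlarged so that $K\subset \mathbb{D}(0,R)$), $\lim_{k\to\infty}\frac{1}{d_k}\log|p_k(z)| = g_\Omega(z)$ uniformly on $\mathbb{C}\setminus\mathbb{D}(0,R)$. Centering: $(p_k)_{k>0}$ centers on a compact set $C$ if there exists $N$ such that (1) there exists $R>0$ with $p_k^{-1}(\{0\})\subset\mathbb{D}(R)$ for all $k\ge N$; and (2) for every closed set $L\subset\mathbb{C}$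 with $L\cap C=\emptyset$ there exists $M=M(L)>0$ such that for all $k\ge N$ the number of roots of $p_k$ in $L$, counted with multiplicity, is at most $M$. *)

(* Defs.v *)
From HB Require Import structures.
From mathcomp Require Import all_boot all_order all_algebra.
From mathcomp Require Export complex.
From mathcomp Require Import all_classical all_reals all_analysis.
Import Order.TTheory GRing.Theory Num.Theory numFieldNormedType.Exports.

Set Implicit Arguments.
Unset Strict Implicit.
Unset Printing Implicit Defensive.

Local Open Scope classical_set_scope.
Local Open Scope ring_scope.

(* The type [R[i]] carries no topology by itself;
   viewing it as a numClosedFieldType gives it the topology of its norm. *)
Definition Cplx (R : realType) : numClosedFieldType := R[i].

Definition borelC (R : realType) := g_sigma_algebraType (@open (Cplx R)).

(* `|z| lives in R[i]; this is the same number as an element of R. *)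
Definition modulus (R : realType) (z : Cplx R) : R := complex.Re `|z|.

(* log |z|, with value -oo at 0. *)
Definition log_mod (R : realType) (z : Cplx R) : \bar R :=
  lne (modulus z)%:E.

(* In the library ln 0 = 0, so that logp 0 = 0, as log^+ requires. *)
Definition logp (R : realType) (x : R) : R := Num.max 0 (ln x).

Section potential_theory.
Local Open Scope ereal_scope.

Definition potential (R : realType) (mu : probability (borelC R) R)
    (z : Cplx R) : \bar R :=
  \int[mu]_w log_mod (z - (w : Cplx R))%R.

(* With this sign convention energies of measures on a compact set are < +oo,
   possibly -oo, and the equilibrium measure maximizes the energy. *)
Definition energy (R : realType) (mu : probability (borelC R) R) : \bar R :=
  \int[mu]_z potential mu z.

(* Borel probability measures carried by K; for K closed this says that the
   support of mu is included in K. *)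
Definition prob_on (R : realType) (K : set (Cplx R)) :
    set (probability (borelC R) R) :=
  [set mu | mu (K : set (borelC R)) = 1].

(* The logarithmic capacity of a compact set K.  The term [set 0] only matters
   for K = set0, which carries no probability measure and has capacity 0. *)
Definition capacity (R : realType) (K : set (Cplx R)) : \bar R :=
  ereal_sup ([set 0] `|` [set expeR (energy mu) | mu in prob_on K]).

Definition non_polar (R : realType) (K : set (Cplx R)) : Prop :=
  0 < capacity K.

Definition equilibrium_measure (R : realType) (K : set (Cplx R))
    (omega : probability (borelC R) R) : Prop :=
  prob_on K omega /\ forall mu, prob_on K mu -> energy mu <= energy omega.

(* The Green's function with pole at infinity of the complement of K, where
   omega is the equilibrium measure of K. *)
Definition green (R : realType) (omega : probability (borelC R) R)
    (z : Cplx R) : \bar R :=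
  potential omega z - energy omega.

End potential_theory.

(* For compact K. *)
Definition polynomially_convex (R : realType) (K : set (Cplx R)) : Prop :=
  connected (~` K).

Definition deg (R : realType) (p : {poly Cplx R}) : nat := (size p).-1.

(* Sequences (p_k)_{k > 0} are functions on nat whose value at 0 is ignored. *)

(* K-regularity, where omega is the equilibrium measure of K.  The distance is
   computed in \bar R: it is +oo where p_k vanishes (log |p_k| = -oo), so an
   inequality < eps%:E also says that p_k has no root with r <= |z|. *)
Definition regular (R : realType) (omega : probability (borelC R) R)
    (p : nat -> {poly Cplx R}) : Prop :=
  exists2 r : R, 0 < r &
    forall eps : R, 0 < eps ->
      \forall k \near \oo, forall z : Cplx R, r <= modulus z ->
        (`| ((deg (p k))%:R^-1)%:E * log_mod (p k).[z] - green omega z |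
           < eps%:E)%E.

(* Number of roots in L, counted with multiplicity, of a nonzero p (a sum with
   finite support). *)
Definition nroots_in (R : realType) (p : {poly Cplx R}) (L : set (Cplx R)) :
    nat :=
  \sum_(z \in L) mup z p.

Definition centers (R : realType) (p : nat -> {poly Cplx R})
    (C : set (Cplx R)) : Prop :=
  exists N : nat,
    (exists2 r : R, 0 < r &
       forall k, (0 < k)%N -> (N <= k)%N ->
         forall z, root (p k) z -> modulus z < r) /\
    (forall L : set (Cplx R), closed L -> L `&` C = set0 ->
       exists2 M : nat, (0 < M)%N &
         forall k, (0 < k)%N -> (N <= k)%N -> (nroots_in (p k) L <= M)%N).

(* Main.v *)
(* Near infinity the Green's function g is at least 1, so |q_k| is exponentially
   larger than |a_k| there: this gives regularity of q_k - a_k and bounds its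
   roots.  To count the roots of q_k - a_k near a point z0 off K, write
   q_k = r_k s_k, where r_k collects the boundedly many roots of q_k near z0.
   Pushing the pole of log |z - x| from infinity to z0 through the connected
   complement of K shows that (1/n_k) log |s_k| tends to g near z0.  As g > 0 off
   K (Frostman's theorem and the minimum principle), r_k - a_k / s_k is an
   exponentially small perturbation of the monic polynomial r_k of bounded degree,
   and the maximum principle bounds its number of zeros near z0.

   Mean values of log |z - x| over circles are replaced by averages over the roots
   of X^N - h^N, whose error decays geometrically in N. *)
Require Import Defs.
From HB Require Import structures.
From mathcomp Require Import all_boot all_order all_algebra.
From mathcomp Require Import all_classical all_reals all_analysis measurable_realfun.
From mathcomp Require Import ring lra.
Import Order.TTheory GRing.Theory Num.Theory numFieldNormedType.Exports.
Local Open Scope classical_set_scope.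
Local Open Scope ring_scope.

Set Implicit Arguments.
Unset Strict Implicit.
Unset Printing Implicit Defensive.

(** * The modulus and the topology of the complex plane *)

(** At a point z0 off K some roots of q_k, boundedly many but moving with k, may sit at or near z0,
    so (1/n_k) log |q_k(z0)| itself need not converge to g(z0). Convergence is therefore stated for
    averages of test functions over the roots near K, normalised by the number of all roots. The
    other roots lie in a bounded region and are boundedly many, so they contribute O(1/n_k) wherever
    the test function is bounded. The class of good test functions is closed under linear
    combinations and under uniform limits near K, which is all that pole pushing uses. The leading
    coefficients of q_k are not controlled either: they cancel in differences log |z - x| - log |z'
    - x| and are restored from regularity at a far point z'.

    The extremality of the equilibrium measure enters through an upper bound for its potential,
    taken with respect to a nonnegative kernel, at every point of a set S of full measure. This S,
    rather than K, is the domain of the integrals. *)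

Section modulus.
Variable R : realType.
Implicit Types (x y z : Cplx R) (e r : R).

Definition ofR (r : R) : Cplx R := real_complex R r.

Lemma normE z : `|z| = ofR (modulus z).
Proof. by rewrite /ofR /modulus RRe_real// normr_real. Qed.

Lemma ofRI : injective ofR.
Proof. by move=> x y []. Qed.

Lemma ofR0 : ofR 0 = 0. Proof. by []. Qed.

Lemma ofR1 : ofR 1 = 1. Proof. by []. Qed.

Lemma ofRD r s : ofR (r + s) = ofR r + ofR s.
Proof. exact: rmorphD. Qed.

Lemma ofRM r s : ofR (r * s) = ofR r * ofR s.
Proof. exact: rmorphM. Qed.

Lemma modulus_ge0 z : 0 <= modulus z.
Proof. by rewrite -lecR -[(modulus z)%:C%C]/(ofR _) -normE normr_ge0. Qed.

Lemma modulusM x y : modulus (x * y) = modulus x * modulus y.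
Proof. by apply: ofRI; rewrite ofRM -!normE normrM. Qed.

Lemma modulusN x : modulus (- x) = modulus x.
Proof. by rewrite /modulus normrN. Qed.

Lemma modulus0 : modulus (0 : Cplx R) = 0.
Proof. by rewrite /modulus normr0. Qed.

Lemma modulus1 : modulus (1 : Cplx R) = 1.
Proof. by rewrite /modulus normr1. Qed.

Lemma modulus_eq0 x : (modulus x == 0) = (x == 0).
Proof.
rewrite -[RHS]normr_eq0 normE; apply/eqP/eqP => [->//|h].
by apply: ofRI; rewrite h.
Qed.

Lemma modulus_gt0 x : (0 < modulus x) = (x != 0).
Proof. by rewrite lt_def modulus_ge0 andbT modulus_eq0. Qed.

Lemma modulusX x n : modulus (x ^+ n) = modulus x ^+ n.
Proof.
by elim: n => [|n IH]; rewrite ?expr0 ?modulus1// !exprS modulusM IH.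
Qed.

Lemma modulusV x : modulus x^-1 = (modulus x)^-1.
Proof.
have [->|x0] := eqVneq x 0; first by rewrite invr0 modulus0 invr0.
have m0 : modulus x != 0 by rewrite modulus_eq0.
by apply: (mulfI m0); rewrite -modulusM !divff// modulus1.
Qed.

Lemma modulusD x y : modulus (x + y) <= modulus x + modulus y.
Proof. by rewrite -lecR rmorphD/= -!/(ofR _) -!normE ler_normD. Qed.

Lemma modulusBC x y : modulus (x - y) = modulus (y - x).
Proof. by rewrite -modulusN opprB. Qed.

Lemma modulus_triangle y x z : modulus (x - z) <= modulus (x - y) + modulus (y - z).
Proof. by rewrite -[x - z](subrKA y) modulusD. Qed.

Lemma modulusB x y : modulus x - modulus y <= modulus (x - y).
Proof. by rewrite lerBlDr -{1}[x](subrK y) modulusD. Qed.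

Lemma modulus_ofR r : modulus (ofR r) = `|r|.
Proof.
by rewrite /modulus normc_def /= expr0n addr0 sqrtr_sqr.
Qed.

Lemma modulusE z : modulus z = Num.sqrt (complex.Re z ^+ 2 + complex.Im z ^+ 2).
Proof. by rewrite /modulus normc_def. Qed.

Lemma modulus_sqr z : modulus z ^+ 2 = complex.Re z ^+ 2 + complex.Im z ^+ 2.
Proof. by rewrite modulusE sqr_sqrtr// addr_ge0// sqr_ge0. Qed.

Lemma Re_le_modulus z : `|complex.Re z| <= modulus z.
Proof.
rewrite modulusE -sqrtr_sqr ler_wsqrtr// lerDl sqr_ge0//.
Qed.

Lemma Im_le_modulus z : `|complex.Im z| <= modulus z.
Proof.
rewrite modulusE -sqrtr_sqr ler_wsqrtr// lerDr sqr_ge0//.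
Qed.

Lemma ReD x y : complex.Re (x + y) = complex.Re x + complex.Re y.
Proof. by case: x y => [a b] [c d]. Qed.

Lemma ReN x : complex.Re (- x) = - complex.Re x.
Proof. by case: x. Qed.

Lemma Re_ofRM r x : complex.Re (ofR r * x) = r * complex.Re x.
Proof. by case: x => a b; rewrite /= mul0r subr0. Qed.

(** Balls of [Cplx R] have radii in [R[i]]; a positive radius is real, so neighbourhoods can be
    described by real radii. *)
Lemma nbhs_modulusP z (A : set (Cplx R)) :
  nbhs z A <-> exists2 e, 0 < e & forall y, modulus (z - y) < e -> A y.
Proof.
split.
- move=> /nbhs_ballP[e/= e0 eA].
  have [r re] : exists r, e = ofR r by apply/complex_realP; exact: gtr0_real.
  move: e0; rewrite re -[0]/(ofR 0) ltcR => r0.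
  exists r => // y yr; apply: eA.
  by rewrite /ball/= normE re ltcR.
- move=> [e e0 eA]; apply/nbhs_ballP; exists (ofR e); first by rewrite /= -[0]/(ofR 0) ltcR.
  by move=> y; rewrite /ball/= normE ltcR => /eA.
Qed.

Lemma open_modulusP (A : set (Cplx R)) :
  open A <-> forall z, A z ->
    exists2 e, 0 < e & forall y, modulus (z - y) < e -> A y.
Proof.
rewrite openE; split => [Ao z /Ao/nbhs_modulusP//|h z /h/nbhs_modulusP//].
Qed.

Lemma closed_modulusP (A : set (Cplx R)) :
  closed A <-> forall z, ~ A z ->
    exists2 e, 0 < e & forall y, modulus (z - y) < e -> ~ A y.
Proof. by rewrite -openC open_modulusP. Qed.

Lemma modulus_dist_closed (A : set (Cplx R)) z : closed A -> ~ A z ->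
  exists2 e, 0 < e & forall w, A w -> e <= modulus (z - w).
Proof.
move=> /closed_modulusP/(_ z) h /h[e e0 eA]; exists e => // w Aw.
by rewrite leNgt; apply/negP => /eA.
Qed.

Lemma continuous_modulusP (T : topologicalType) (f : T -> Cplx R) t :
  (forall e, 0 < e -> \forall s \near t, modulus (f t - f s) < e) ->
  {for t, continuous f}.
Proof.
move=> h A /nbhs_modulusP[e e0 eA]; have := h _ e0.
by apply: filterS => s; exact: eA.
Qed.

Lemma compact_modulus_bounded (A : set (Cplx R)) : compact A ->
  exists2 B, 0 < B & forall z, A z -> modulus z < B.
Proof.
move=> cA.
have : cover_compact A by rewrite -compact_cover.
move=> /(_ nat setT (fun n => [set z | modulus z < n%:R])) [].
- move=> n _; apply/open_modulusP => z /= zn.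
  exists (n%:R - modulus z); first by rewrite subr_gt0.
  move=> y yz; have := modulusD z (y - z); rewrite addrC subrK modulusBC => /le_lt_trans; apply.
  by rewrite -ltrBrDl.
- move=> z Az; exists (Num.trunc (modulus z)).+1 => //=.
  by rewrite truncnS_gt.
move=> D _ DA.
exists (\sum_(n <- finmap.enum_fset D) n%:R + 1) => [|z /DA[n/= nD]].
  by rewrite ltr_wpDl// sumr_ge0.
move=> /lt_trans; apply; rewrite ltr_pwDr// (big_rem n)//= lerDl.
by rewrite sumr_ge0.
Qed.

Lemma compact_modulus_closed (A : set (Cplx R)) : compact A -> closed A.
Proof. by apply: compact_closed; exact: norm_hausdorff. Qed.

(** The disc is a closed subset of the image of a square under the continuous map (x, y) -> x + i
    y. *)
Lemma compact_disc r : compact [set z : Cplx R | modulus z <= r].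
Proof.
pose f (p : R * R) : Cplx R := Complex p.1 p.2.
have cf : continuous f.
  move=> p; apply: continuous_modulusP => e e0.
  have e20 : 0 < e / 2 by rewrite divr_gt0.
  have : nbhs p (ball p (e / 2)) by exact: nbhsx_ballx.
  apply: filterS => -[x y] /= [/=]; rewrite /ball /= => hx hy.
  have -> : f p - f (x, y) = ofR (p.1 - x) + 'i%C * ofR (p.2 - y).
    by rewrite /f /ofR; simpc.
  rewrite (le_lt_trans (modulusD _ _))// modulusM modulus_ofR.
  rewrite [X in X * _]modulusE/= expr0n add0r expr1n sqrtr1 mul1r modulus_ofR.
  by rewrite [e]splitr ltrD.
have cI : compact (`[-r, r] : set R) by exact: segment_compact.
have cd : compact (f @` (`[-r, r] `*` `[-r, r])).
  by apply: continuous_compact; [exact: continuous_subspaceT|exact: compact_setX].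
apply: (subclosed_compact _ cd).
  apply/closed_modulusP => z /= /negP; rewrite -ltNge => rz.
  exists (modulus z - r); first by rewrite subr_gt0.
  move=> y yz; apply/negP; rewrite -ltNge.
  have := modulusB z y; lra.
move=> z /= zr; exists (complex.Re z, complex.Im z); last by case: z {zr}.
by split => /=; rewrite in_itv/= -ler_norml (le_trans _ zr)// ?Re_le_modulus ?Im_le_modulus.
Qed.

End modulus.

Section topology.
Variable R : realType.
Implicit Types (x y z : Cplx R) (e r : R) (A : set (Cplx R)).

Lemma lipschitz1_continuous (f : Cplx R -> R) :
  (forall x y, `|f x - f y| <= modulus (x - y)) -> continuous f.
Proof.
move=> fl z; apply/(cvgrPdist_lt (F := nbhs z)) => e e0.
by apply/nbhs_modulusP; exists e => // y; exact: le_lt_trans.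
Qed.

Lemma modulus_continuous : continuous (@modulus R).
Proof.
apply: lipschitz1_continuous => x y; rewrite ler_norml modulusB andbT.
by rewrite lerNl opprB modulusBC modulusB.
Qed.

Lemma Re_continuous : continuous (@complex.Re R : Cplx R -> R).
Proof.
by apply: lipschitz1_continuous => x y; rewrite -ReN -ReD Re_le_modulus.
Qed.

Lemma Im_continuous : continuous (@complex.Im R : Cplx R -> R).
Proof.
apply: lipschitz1_continuous => x y.
by rewrite (_ : _ - _ = complex.Im (x - y)) ?Im_le_modulus//; case: x y => [a b] [c d].
Qed.

Lemma horner_continuous (p : {poly Cplx R}) : continuous (fun z => p.[z]).
Proof.
elim/poly_ind: p => [|p c IH] z.
  under eq_fun do rewrite horner0; exact: cst_continuous.
under eq_fun do rewrite hornerMXaddC.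
apply: (@continuousD _ (Cplx R) _ (fun z => p.[z] * z) (fun=> c)); last exact: cst_continuous.
by apply: (@continuousM (Cplx R) _ (horner p) id); [exact: IH|exact: cvg_id].
Qed.

Lemma modulus_horner_continuous (p : {poly Cplx R}) :
  continuous (fun z => modulus p.[z]).
Proof.
by move=> z; apply: continuous_comp; [exact: horner_continuous|exact: modulus_continuous].
Qed.

(** The clopen argument, with relative openness of [A] and of its complement in [Om] tested on
    discs. Unions of these discs are the open sets of the plane whose traces on [Om] connectedness
    speaks of. *)
Lemma connected_clopen (Om A : set (Cplx R)) :
  connected Om -> A `&` Om !=set0 ->
  (forall z, Om z -> A z -> exists2 e, 0 < e &
    forall y, Om y -> modulus (z - y) < e -> A y) ->
  (forall z, Om z -> ~ A z -> exists2 e, 0 < e &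
    forall y, Om y -> modulus (z - y) < e -> ~ A y) ->
  Om `<=` A.
Proof.
move=> cOm AOm Aopen Aclosed.
have near_of (P Q : set (Cplx R)) : (forall z, P z -> Q z -> exists2 e, 0 < e &
    forall y, P y -> modulus (z - y) < e -> Q y) ->
  P `&` Q = P `&` [set y | exists z e, [/\ P z, Q z, modulus (z - y) < e &
    forall y, P y -> modulus (z - y) < e -> Q y]].
  move=> h; apply/seteqP; split => y [Py Qy]; split => //.
    have [e e0 eQ] := h y Py Qy; exists y, e; split => //.
    by rewrite subrr modulus0.
  by case: Qy => z [e [Pz Qz zy]]; apply.
have near_open (P Q : set (Cplx R)) : open [set y | exists z e, [/\ P z, Q z, modulus (z - y) < e &
    forall y, P y -> modulus (z - y) < e -> Q y]].
  apply/open_modulusP => y [z [e [Pz Qz zy eQ]]].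
  exists (e - modulus (z - y)); first by rewrite subr_gt0.
  move=> u yu; exists z, e; split => //.
  by rewrite (le_lt_trans (modulus_triangle y _ _))// -ltrBrDl.
suff <- : Om `&` A = Om by move=> z [].
apply: cOm; first by rewrite setIC.
- by eexists; last exact: (near_of _ _ Aopen).
- eexists; first by apply/open_closedC/(near_open Om (~` A)).
  rewrite -setDE; have := near_of Om (~` A) Aclosed.
  rewrite -!setDE => h.
  rewrite -[LHS]setDD h; apply/seteqP; split => z [Omz]; rewrite /setD/=.
    by move=> nz; split => // zz; apply: nz; split.
  by move=> nz; split => // -[].
Qed.

(** A finite subcover by discs satisfying [P] is assembled one disc at a time. This turns local
    bounds on numbers of roots into bounds on compact sets. *)
Lemma compact_induction A (P : set (Cplx R) -> Prop) :
  compact A -> P set0 -> (forall B C, P B -> P C -> P (B `|` C)) ->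
  (forall B C, B `<=` C -> P C -> P B) ->
  (forall z, A z -> exists2 e, 0 < e & P [set y | modulus (z - y) < e]) ->
  P A.
Proof.
move=> cA P0 PU Psub Ploc.
have : cover_compact A by rewrite -compact_cover.
move=> /(_ (Cplx R * R)%type [set p | 0 < p.2 /\ P [set y | modulus (p.1 - y) < p.2]]
  (fun p => [set y | modulus (p.1 - y) < p.2])) [].
- move=> [z e] /= [e0 _]; apply/open_modulusP => y /= zy.
  exists (e - modulus (z - y)); first by rewrite subr_gt0.
  by move=> u yu; rewrite (le_lt_trans (modulus_triangle y _ _))// -ltrBrDl.
- by move=> z /Ploc[e e0 Pe]; exists (z, e) => //=; rewrite subrr modulus0.
move=> D DP /Psub; apply.
have {}DP p : p \in finmap.enum_fset D -> P [set y | modulus (p.1 - y) < p.2].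
  by move=> /DP; rewrite inE => -[].
rewrite (_ : cover _ _ = [set y | exists2 p, p \in finmap.enum_fset D & modulus (p.1 - y) < p.2])//.
elim: (finmap.enum_fset D) DP => [_|p s IH DP].
  by apply: Psub P0 => y [].
apply: Psub (PU _ _ (DP p _) (IH _)); first last.
- by move=> q qs; apply: DP; rewrite inE qs orbT.
- by rewrite inE eqxx.
- move=> y [q]; rewrite inE => /orP[/eqP ->|qs] ?; [left|right] => //.
  by exists q.
Qed.

Lemma compact_max A (f : Cplx R -> R) : A !=set0 -> compact A ->
  (forall z, A z -> {for z, continuous f}) ->
  exists2 z, A z & forall y, A y -> f y <= f z.
Proof.
move=> A0 cA fc; have [|z] := @compact_EVT_max _ _ f A A0 cA.
  apply: continuous_in_subspaceT => z; rewrite inE; exact: fc.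
by rewrite inE => Az h; exists z => // y Ay; apply: h; rewrite inE.
Qed.

End topology.

(** * Maximum modulus principle and counting of zeros *)

Section rational_maximum.
Variable R : realType.
Implicit Types (z : Cplx R) (t s : {poly Cplx R}).

(* Near a zero of order m of t/s - w0, the quotient t/s is w0 (1 + b h^m) up to a
   smaller term, so it increases in modulus in the directions h with b h^m > 0. *)
Lemma rational_not_max t s z : s.[z] != 0 -> t.[z] != 0 ->
  t * s.[z]%:P != s * t.[z]%:P ->
  forall e, 0 < e -> exists2 y, modulus (z - y) < e &
    s.[y] != 0 /\ modulus t.[z] * modulus s.[y] < modulus t.[y] * modulus s.[z].
Proof.
move=> sz0 tz0; rewrite -subr_eq0 => P0 e e0.
have [m [T /implyP/(_ P0) Tz PE]] := multiplicity_XsubC (t * s.[z]%:P - s * t.[z]%:P) z.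
have m0 : (0 < m)%N.
  rewrite lt0n; apply/eqP => m0; move: Tz; rewrite /root.
  have := congr1 (horner^~ z) PE; rewrite m0 expr0 mulr1 => <-.
  by rewrite !hornerE mulrC subrr eqxx.
(* [b] is the leading coefficient of the relative variation: (t/s)(y) divided by (t/s)(z) is 1 + b
   (y - z)^m up to a smaller term. With u^m = 1/b, the direction y - z = r u makes the main term r^m
   > 0. *)
pose b := T.[z] / (t.[z] * s.[z]).
have Tz0 : T.[z] != 0 by [].
have b0 : b != 0 by rewrite mulf_neq0// invr_eq0 mulf_neq0.
have [u um] : exists u, u ^+ m = b^-1.
  have : size ('X^m - (b^-1)%:P) != 1 by rewrite size_XnsubC// eqSS -lt0n.
  move=> /closed_rootP[u]; rewrite /root !hornerE subr_eq0 => /eqP; by exists u.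
have u0 : u != 0.
  by apply: contra_neq (invr_neq0 b0) => u0; rewrite -um u0 expr0n gtn_eqF.
(* [D] vanishes at [z] and measures the error of replacing T/s by its value at [z]; the bound on [D]
   near [z] makes this error strictly smaller than the gain r^m. *)
pose D := T * s.[z]%:P - s * T.[z]%:P.
have [d d0 dP] : exists2 d, 0 < d & forall y, modulus (z - y) < d ->
    modulus D.[y] < modulus s.[y] * modulus T.[z].
  apply/nbhs_modulusP.
  have : {for z, continuous (fun y => modulus s.[y] * modulus T.[z] - modulus D.[y])}.
    apply: (@continuousB _ R _ (fun y => modulus s.[y] * modulus T.[z])); last exact: modulus_horner_continuous.
    by apply: (@continuousM R _ (fun y => modulus s.[y]) (fun=> modulus T.[z])); [exact: modulus_horner_continuous|exact: cst_continuous].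
  move=> /(cvgr_gt (F := nbhs z)) /(_ 0) h.
  apply: filterS (h _) => [y|]; first by rewrite subr_gt0.
  rewrite /D !hornerE [X in modulus (_ - X)]mulrC subrr modulus0 subr0.
  by rewrite mulr_gt0 ?modulus_gt0.
pose r := Num.min d e / (2 * modulus u).
have um0 : 0 < modulus u by rewrite modulus_gt0.
have de0 : 0 < Num.min d e by rewrite lt_min d0.
have r0 : 0 < r by rewrite divr_gt0// mulr_gt0.
have rde : modulus (ofR r * u) < Num.min d e.
  rewrite modulusM modulus_ofR gtr0_norm// /r invfM mulrA mulfVK ?gt_eqF//.
  by rewrite ltr_pdivrMr// ltr_pMr// ltr1n.
pose y := z + ofR r * u.
have zy : modulus (z - y) = modulus (ofR r * u) by rewrite /y opprD addNKr modulusN.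
move: rde; rewrite -zy lt_min => /andP[yd ye].
exists y => //.
have Dy := dP _ yd.
have sy0 : s.[y] != 0.
  by rewrite -modulus_gt0 -(pmulr_lgt0 _ (_ : 0 < modulus T.[z])) ?modulus_gt0// (le_lt_trans _ Dy) ?modulus_ge0.
split => //.
have ryE : (y - z) ^+ m = ofR (r ^+ m) * b^-1.
  by rewrite /y addrAC subrr add0r exprMn um [ofR (r ^+ m)]rmorphXn.
have rm0 : 0 < r ^+ m by rewrite exprn_gt0.
have key : t.[y] * s.[z] =
    s.[y] * t.[z] * ofR (1 + r ^+ m) + ofR (r ^+ m) * b^-1 * (D.[y] / s.[z]).
  have := congr1 (horner^~ y) PE; rewrite /D !hornerE ryE => /eqP.
  rewrite subr_eq => /eqP ->.
  rewrite ofRD ofR1 /b /=; field.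
  by rewrite Tz0 tz0 sz0.
have st0 : 0 < modulus s.[y] * modulus t.[z] by rewrite mulr_gt0 ?modulus_gt0.
have h1 : modulus (s.[y] * t.[z] * ofR (1 + r ^+ m)) =
    modulus s.[y] * modulus t.[z] * (1 + r ^+ m).
  by rewrite !modulusM modulus_ofR ger0_norm// addr_ge0// ltW.
have h2 : modulus (ofR (r ^+ m) * b^-1 * (D.[y] / s.[z])) <
    modulus s.[y] * modulus t.[z] * r ^+ m.
  rewrite /b !(modulusM, modulusV) modulus_ofR gtr0_norm//.
  have T0 : 0 < modulus T.[z] by rewrite modulus_gt0.
  have s0 : 0 < modulus s.[z] by rewrite modulus_gt0.
  have t0 : 0 < modulus t.[z] by rewrite modulus_gt0.
  rewrite [X in X < _](_ : _ = modulus D.[y] * (r ^+ m * modulus t.[z] / modulus T.[z])).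
    rewrite [X in _ < X](_ : _ = modulus s.[y] * modulus T.[z] * (r ^+ m * modulus t.[z] / modulus T.[z])).
      by rewrite ltr_pM2r// divr_gt0// mulr_gt0.
    by field; rewrite gt_eqF.
  by field; rewrite !gt_eqF.
rewrite -[X in _ < X]modulusM key.
set u1 := _ * ofR _ in h1 *; set u2 := _ * _ * _ in h2 *.
have := modulusB u1 (- u2); rewrite opprK modulusN h1.
by rewrite [X in X < _]mulrC; move: h2; lra.
Qed.

(** At a maximum point of |t| / |s| on the closed disc, [rational_not_max] leaves three cases: the
    point is on the circle, [t] vanishes there, or t/s is constant. *)
Lemma rational_max_modulus t s z0 (rho B : R) : 0 < rho ->
  (forall z, modulus (z - z0) <= rho -> s.[z] != 0) ->
  (forall z, modulus (z - z0) = rho -> modulus t.[z] <= B * modulus s.[z]) ->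
  forall z, modulus (z - z0) <= rho -> modulus t.[z] <= B * modulus s.[z].
Proof.
move=> rho0 s0 tB z zr.
pose A := [set y : Cplx R | modulus (y - z0) <= rho].
have cA : compact A.
  apply: (subclosed_compact _ (@compact_disc R (rho + modulus z0))).
    apply/closed_modulusP => y /negP; rewrite -ltNge => yr.
    exists (modulus (y - z0) - rho); first by rewrite subr_gt0.
    move=> u yu; apply/negP; rewrite -ltNge.
    have := modulus_triangle u y z0; move: yu; lra.
  move=> y /= Ay; have := modulusD (y - z0) z0; rewrite subrK; move: Ay; rewrite /A/=; lra.
pose f y := modulus t.[y] * (modulus s.[y])^-1.
have [||y Ay yM] := @compact_max R A f _ cA.
- by exists z.
- move=> y Ay; apply: (@continuousM R _ (fun y => modulus t.[y]) (fun y => (modulus s.[y])^-1)).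
    exact: modulus_horner_continuous.
  apply: (@continuousV _ _ (fun y => modulus s.[y])); last exact: modulus_horner_continuous.
  by rewrite modulus_eq0 s0.
have sA u : A u -> 0 < modulus s.[u] by move=> Au; rewrite modulus_gt0 s0.
suff fy : f y <= B by rewrite -ler_pdivrMr ?sA// (le_trans (yM z zr)).
(* One point of the circle suffices for the last two cases: it shows B >= 0 when [t] vanishes at the
   maximum, and carries the value of a constant quotient. *)
have edge : exists2 u, A u & modulus (u - z0) = rho.
  exists (z0 + ofR rho); rewrite /A/= addrAC subrr add0r modulus_ofR gtr0_norm//.
have fedge u : modulus (u - z0) = rho -> f u <= B.
  by move=> ur; rewrite ler_pdivrMr ?tB// sA// /A/= ur.
have [ty0|ty0] := eqVneq t.[y] 0.
  have [u Au /fedge] := edge; apply: le_trans.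
  by rewrite /f ty0 modulus0 mul0r divr_ge0// modulus_ge0.
move: (Ay); rewrite /A/= le_eqVlt => /orP[/eqP/fedge//|yr].
have [tsE|tsN] := eqVneq (t * s.[y]%:P) (s * t.[y]%:P).
  have [u Au ur] := edge.
  suff -> : f y = f u by exact: fedge.
  have := congr1 (fun p => modulus p.[u]) tsE; rewrite !hornerE !modulusM /f => h.
  have sn v : A v -> modulus s.[v] != 0 by move=> Av; rewrite gt_eqF ?sA.
  apply/eqP; rewrite eqr_div ?sn//; apply/eqP.
  by rewrite h mulrC.
have [|u yu [su0]] := rational_not_max (s0 _ Ay) ty0 tsN (_ : 0 < rho - modulus (y - z0)).
  by rewrite subr_gt0.
have Au : A u.
  rewrite /A/=; have := modulus_triangle y u z0; rewrite (modulusBC u y).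
  by move: yu; lra.
rewrite ltNge => /negP[]; have := yM u Au.
by rewrite /f ler_pdivrMr ?sA// mulrAC ler_pdivlMr ?sA.
Qed.
End rational_maximum.

(** * Taylor expansion of log |1 - x| with remainder *)

Section log_taylor.
Variable R : realType.
Implicit Types (x y z : Cplx R) (t : R).

Lemma modulus_sub1_ge x : modulus x <= 2^-1 -> 2^-1 <= modulus (1 - x).
Proof. by move=> x2; have := modulusB (1 : Cplx R) x; rewrite modulus1; lra. Qed.

(** Mean value theorem on [0, 1] for F(t), the left-hand side at t x without absolute value: its
    derivative telescopes to - Re (x (t x)^m / (1 - t x)), and |1 - t x| >= 1/2. Writing log |1 - t
    x| as half the logarithm of the real polynomial [Q] keeps all derivatives real. The case m = 0
    is the estimate |log |1 - x|| <= 2 |x|. *)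
Lemma ln_modulus_taylor m x : modulus x <= 2^-1 ->
  `|ln (modulus (1 - x)) + \sum_(i < m) complex.Re (x ^+ i.+1) / i.+1%:R|
    <= 2 * modulus x ^+ m.+1.
Proof.
move=> x2; pose a := complex.Re x; pose b := complex.Im x.
pose Q : {poly R} := (1 - a *: 'X) ^+ 2 + (b *: 'X) ^+ 2.
have QE t : Q.[t] = modulus (1 - ofR t * x) ^+ 2.
  rewrite modulus_sqr /Q !hornerE /a /b; case: (x) => u v /=.
  by congr (_ ^+ 2 + _); ring.
have tx t : 0 <= t <= 1 -> modulus (ofR t * x) <= modulus x.
  move=> /andP[t0 t1]; rewrite modulusM modulus_ofR ger0_norm//.
  by rewrite ler_piMl// modulus_ge0.
have tx2 t : 0 <= t <= 1 -> 2^-1 <= modulus (1 - ofR t * x).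
  by move=> t01; apply: modulus_sub1_ge; exact: le_trans (tx _ t01) x2.
have Q0 t : 0 <= t <= 1 -> 0 < Q.[t].
  by move=> t01; rewrite QE exprn_gt0// (lt_le_trans _ (tx2 _ t01)).
pose c i := complex.Re (x ^+ i.+1).
pose P : {poly R} := \sum_(i < m) (c i / i.+1%:R) *: 'X^(i.+1).
pose F t := 2^-1 * ln Q.[t] + P.[t].
pose dF t := 2^-1 * (Q.[t]^-1 * Q^`().[t]) + P^`().[t].
have Fd t : 0 <= t <= 1 -> is_derive t 1 F (dF t).
  move=> t01; have := is_derive_poly P t.
  have := @is_derive1_comp _ (@ln R) (horner Q) t _ _ (is_derive1_ln (Q0 _ t01)) (is_derive_poly Q t).
  move=> /(is_deriveZ (2^-1 : R)) h1 h2.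
  exact: is_deriveD h1 h2.
have [t] : exists2 t, t \in `[0, 1]%R & F 1 - F 0 = dF t * (1 - 0).
  apply: MVT_segment => //.
    by move=> t; rewrite in_itv/= => /andP[t0 t1]; apply: Fd; rewrite !ltW.
  apply: derivable_within_continuous => t; rewrite in_itv/= => /Fd.
  by move=> ?; exact: ex_derive.
rewrite in_itv/= => t01.
have -> : F 0 = 0.
  rewrite /F QE ofR0 mul0r subr0 modulus1 expr1n ln1 mulr0 add0r /P.
  by rewrite horner_sum big1// => i _; rewrite !hornerE expr0n mulr0.
have -> : F 1 = ln (modulus (1 - x)) + \sum_(i < m) complex.Re (x ^+ i.+1) / i.+1%:R.
  rewrite /F QE ofR1 mul1r lnXn; last first.
    by rewrite (lt_le_trans _ (modulus_sub1_ge x2)).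
  congr (_ + _); first by rewrite -mulr_natr; field.
  rewrite horner_sum; apply: eq_bigr => i _.
  by rewrite !hornerE expr1n mulr1.
rewrite !subr0 mulr1 => ->.
have t1x : 1 - ofR t * x != 0 by rewrite -modulus_gt0 (lt_le_trans _ (tx2 _ t01)).
have -> : dF t = complex.Re (- (x * (ofR t * x) ^+ m / (1 - ofR t * x))).
  transitivity (complex.Re (- x / (1 - ofR t * x) + \sum_(i < m) x * (ofR t * x) ^+ i)).
    rewrite ReD /dF; congr (_ + _).
      have -> : Q^`().[t] = 2 * (- a * (1 - t * a) + t * b ^+ 2).
        rewrite /Q !(derivD, derivN, derivC, deriv_exp, derivZ, derivX).
        by rewrite !hornerE /=; ring.
      have := Q0 _ t01; rewrite QE modulus_sqr /a /b.
      case: (x) => u v /=; rewrite !mul0r !subr0 !addr0 !sub0r !sqrrN => n0.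
      by field; rewrite gt_eqF.
    rewrite /P raddf_sum horner_sum.
    rewrite (big_morph (@complex.Re R) (id1 := 0) (op1 := +%R) (@ReD R))//.
    apply: eq_bigr => i _.
    rewrite /= derivZ derivXn !hornerE /= hornerMn hornerXn /c exprMn -rmorphXn/=.
    rewrite mulrCA -exprS [RHS]Re_ofRM.
    by rewrite -[t ^+ i *+ _]mulr_natr mulrA mulrAC mulfVK ?pnatr_eq0// mulrC.
  congr complex.Re; rewrite -mulr_sumr.
  rewrite (_ : \sum_(i < m) _ = (1 - (ofR t * x) ^+ m) / (1 - ofR t * x)).
    by field.
  apply: (mulIf t1x); rewrite mulfVK// mulrC -[1 - _]opprB mulNr -subrX1 opprB//.
rewrite (le_trans (Re_le_modulus _))// modulusN !modulusM modulusV modulusX.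
rewrite exprSr [X in _ <= X]mulrC.
have h := tx2 _ t01.
have h0 : 0 < modulus (1 - ofR t * x) by exact: lt_le_trans h.
rewrite ler_pM//.
- by rewrite mulr_ge0 ?exprn_ge0 ?modulus_ge0.
- by rewrite invr_ge0 ltW.
- rewrite mulrC ler_wpM2r ?modulus_ge0// lerXn2r ?nnegrE ?modulus_ge0//.
  exact: tx.
- by rewrite invf_ple ?posrE.
Qed.
End log_taylor.

(** * Discrete mean values of log |u - r| *)

Section mean_value.
Variable R : realType.
Implicit Types (x y z h u : Cplx R).

Lemma XnsubC_roots N h : (0 < N)%N -> exists rs : seq (Cplx R),
  [/\ 'X^N - (h ^+ N)%:P = \prod_(r <- rs) ('X - r%:P), size rs = N,
    h \in rs & forall r, r \in rs -> modulus r = modulus h].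
Proof.
move=> N0; have [rs E] := closed_field_poly_normal ('X^N - (h ^+ N)%:P).
have mon : 'X^N - (h ^+ N)%:P \is monic by rewrite monicXnsubC.
move: E; rewrite (monicP mon) scale1r => E; exists rs.
have rootE r : (r \in rs) = (r ^+ N == h ^+ N).
  by rewrite -root_prod_XsubC -E /root !hornerE subr_eq0.
split => //.
- by have := size_XnsubC (h ^+ N) N0; rewrite E size_prod_XsubC => -[].
- by rewrite rootE.
- move=> r; rewrite rootE => /eqP/(congr1 (@modulus R)); rewrite !modulusX => /eqP.
  by rewrite eqrXn2 ?modulus_ge0// => /eqP.
Qed.

Lemma sum_ln_modulus (I : eqType) (s : seq I) (f : I -> Cplx R) :
  (forall i, i \in s -> f i != 0) ->
  \sum_(i <- s) ln (modulus (f i)) = ln (modulus (\prod_(i <- s) f i)).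
Proof.
elim: s => [|i s IH] f0; first by rewrite !big_nil modulus1 ln1.
rewrite !big_cons modulusM lnM ?posrE ?modulus_gt0 ?f0 ?mem_head//; last first.
  by rewrite prodf_seq_neq0; apply/allP => j js; rewrite f0// inE js orbT.
by rewrite IH// => j js; rewrite f0// inE js orbT.
Qed.

(** The product of the factors u - r is u^N - h^N = u^N (1 - (h/u)^N), and |(h/u)^N| <= 2^-N. The
    error bounds the whole sum, before any division by N. *)
Lemma ln_modulus_mean N h u rs : u != 0 -> modulus h <= modulus u / 2 ->
  (0 < N)%N -> 'X^N - (h ^+ N)%:P = \prod_(r <- rs) ('X - r%:P) ->
  `|\sum_(r <- rs) ln (modulus (u - r)) - N%:R * ln (modulus u)| <= 2 * 2^-1 ^+ N.
Proof.
move=> u0 hu N0 E.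
have mu0 : 0 < modulus u by rewrite modulus_gt0.
have x2 : modulus ((h / u) ^+ N) <= 2^-1 ^+ N.
  rewrite modulusX lerXn2r ?nnegrE ?modulus_ge0// modulusM modulusV.
  by rewrite ler_pdivrMr// mulrC.
have x2' : modulus ((h / u) ^+ N) <= 2^-1.
  by rewrite (le_trans x2)// -[leRHS]expr1 ler_wiXn2l//; lra.
have nz : u ^+ N - h ^+ N != 0.
  rewrite (_ : _ - _ = u ^+ N * (1 - (h / u) ^+ N)); last first.
    by rewrite mulrBr mulr1 -exprMn mulrC mulfVK.
  rewrite mulf_neq0// ?expf_neq0// -modulus_gt0.
  by rewrite (lt_le_trans _ (modulus_sub1_ge x2')).
have nzr r : r \in rs -> u - r != 0.
  move=> rrs; apply: contraNneq nz => ur.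
  have := congr1 (horner^~ u) E; rewrite !hornerE horner_prod => ->.
  by rewrite prodf_seq_eq0; apply/hasP; exists r => //=; rewrite !hornerE ur.
have -> := @sum_ln_modulus _ rs (fun r => u - r) nzr.
have -> : \prod_(r <- rs) (u - r) = u ^+ N * (1 - (h / u) ^+ N).
  have := congr1 (horner^~ u) E; rewrite !hornerE horner_prod.
  under eq_bigr do rewrite !hornerE.
  by move=> <-; rewrite mulrBr mulr1 -exprMn [u * _]mulrC mulfVK.
rewrite modulusM modulusX lnM ?posrE ?exprn_gt0//; last first.
  by rewrite (lt_le_trans _ (modulus_sub1_ge x2')).
rewrite lnXn// mulr_natl addrAC subrr add0r.
have := ln_modulus_taylor 0 x2'; rewrite big_ord0 addr0 expr1 => /le_trans; apply.
by rewrite ler_wpM2l.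
Qed.

End mean_value.

(** * Zeros of a perturbed polynomial in a disc *)

Section counting.
Variable R : realType.
Implicit Types (x y z h u : Cplx R).

(* Each point costs a factor 8 in the radius. *)
Lemma disc_avoid (l : seq (Cplx R)) z0 (e : R) : 0 < e ->
  exists z1, modulus (z1 - z0) <= e /\ forall x, x \in l -> e / 8 ^+ size l <= modulus (z1 - x).
Proof.
elim: l z0 e => [|x l IH] z0 e e0.
  by exists z0; rewrite subrr modulus0 ltW.
(* The disc of radius e/8 about such a [c] stays within e of [z0], as 3/4 + 1/8 < 1, and at distance
   at least e/4 - e/8 from [x]; the other points are avoided inside it. *)
have [c [c0 cx]] : exists c, modulus (c - z0) <= 3 / 4 * e /\ e / 4 <= modulus (c - x).
  have [zx|zx] := leP (e / 2) (modulus (z0 - x)).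
    by exists z0; rewrite subrr modulus0; split; lra.
  exists (z0 + ofR (3 / 4 * e)); rewrite addrAC subrr add0r modulus_ofR.
  rewrite gtr0_norm; last lra.
  split => //.
  rewrite (_ : z0 + _ - x = ofR (3 / 4 * e) - (x - z0)); last by ring.
  have := modulusB (ofR (3 / 4 * e)) (x - z0).
  rewrite modulus_ofR gtr0_norm ?(modulusBC x); last lra.
  lra.
have [|z1 [z1c z1l]] := IH c (e / 8); first by lra.
exists z1; split.
  by have := modulus_triangle c z1 z0; lra.
move=> y; rewrite inE => /orP[/eqP ->|/z1l].
  have h := modulus_triangle z1 c x; rewrite (modulusBC c z1) in h.
  have : e / 8 ^+ size (x :: l) <= e / 8.
    rewrite ler_pM2l// lef_pV2 ?posrE ?exprn_gt0// -[leLHS]expr1 ler_weXn2l//; lra.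
  lra.
by apply: le_trans; rewrite /= exprS invfM mulrA.
Qed.

Lemma prod_XsubC_ge (l : seq (Cplx R)) z (b : R) : 0 <= b ->
  (forall x, x \in l -> b <= modulus (z - x)) ->
  b ^+ size l <= modulus (\prod_(x <- l) (z - x)).
Proof.
move=> b0; elim: l => [|x l IH] h; first by rewrite big_nil modulus1.
rewrite big_cons modulusM exprS ler_pM ?exprn_ge0//.
  by rewrite h// mem_head.
by apply: IH => y yl; rewrite h// inE yl orbT.
Qed.

Lemma prod_XsubC_le (l : seq (Cplx R)) z (b : R) : 0 <= b ->
  (forall x, x \in l -> modulus (z - x) <= b) ->
  modulus (\prod_(x <- l) (z - x)) <= b ^+ size l.
Proof.
move=> b0; elim: l => [|x l IH] h; first by rewrite big_nil modulus1.
rewrite big_cons modulusM exprS ler_pM ?modulus_ge0//.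
  by rewrite h// mem_head.
by apply: IH => y yl; rewrite h// inE yl orbT.
Qed.
End counting.

Section counting.
Variable R : realType.
Implicit Types (x y z h u : Cplx R).

Lemma geometric_small (q e : R) : 0 <= q < 1 -> 0 < e ->
  exists N, forall n, (N <= n)%N -> q ^+ n < e.
Proof.
move=> /andP[q0 q1] e0.
have : (q ^+ n @[n --> \oo] --> 0).
  by apply: cvg_expr; rewrite ger0_norm.
move=> /cvgrPdist_lt/(_ e e0)[N _ Ne]; exists N => n /Ne /=.
by rewrite sub0r normrN ger0_norm// exprn_ge0.
Qed.

(* With f = (r s - a) / s = r - a / s: on the circle of radius tau f is bounded,
   at some point near z0 it is not too small, so by the maximum principle for
   f / prod (z - zeta) it has few zeros zeta near z0. *)
Lemma zero_count_bound z0 (tau b : R) (M : nat) : 0 < tau -> 1 <= b ->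
  exists2 eta : R, 0 < eta & exists Nmax : nat,
  forall (lr zs : seq (Cplx R)) (s t : {poly Cplx R}) (a : Cplx R),
  (size lr <= M)%N ->
  (forall x z, x \in lr -> modulus (z - z0) <= tau -> modulus (z - x) <= b) ->
  (forall z, modulus (z - z0) <= tau -> s.[z] != 0) ->
  (forall z, modulus (z - z0) <= tau -> modulus a <= eta * modulus s.[z]) ->
  (\prod_(x <- lr) ('X - x%:P)) * s - a%:P = t * \prod_(x <- zs) ('X - x%:P) ->
  (forall x, x \in zs -> modulus (x - z0) <= tau / 4) ->
  (size zs <= Nmax)%N.
Proof.
move=> tau0 b1.
(* [disc_avoid] gives a point within tau/4 of [z0] at distance at least [c] from at most [M] roots.
   As c <= 1, the product over [lr] is at least c^M there whatever its length, and eta = c^M / 2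
   lets the constant [a] consume half of that. *)
pose c := Num.min 1 (tau / 4 / 8 ^+ M).
have c0 : 0 < c by rewrite lt_min ltr01 !divr_gt0// exprn_gt0.
have c1 : c <= 1 by rewrite ge_min lexx.
have eta0 : 0 < c ^+ M / 2 by rewrite divr_gt0// exprn_gt0.
exists (c ^+ M / 2) => //.
have b0 : 0 <= b by lra.
have B0 : 0 < b ^+ M + 1 by rewrite ltr_wpDl// exprn_ge0.
(* Each zero in [zs] is at distance at least 3 tau / 4 from the circle and at most tau / 2 from the
   chosen point, so it contributes a factor 2/3. *)
have [|N Nsmall] := @geometric_small (2 / 3) (c ^+ M / 2 / (b ^+ M + 1)) _ (divr_gt0 eta0 B0).
  by apply/andP; split; lra.
exists N => lr zs s t a lrM lrb s0 sa E zst.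
rewrite leqNgt; apply/negP => /ltnW/Nsmall; apply/negP; rewrite -leNgt.
set n := size zs.
have prodE (l : seq (Cplx R)) z : (\prod_(x <- l) ('X - x%:P)).[z] = \prod_(x <- l) (z - x).
  by rewrite horner_prod; apply: eq_bigr => x _; rewrite !hornerE.
have EE z : (\prod_(x <- lr) (z - x)) * s.[z] - a = t.[z] * \prod_(x <- zs) (z - x).
  by have := congr1 (horner^~ z) E; rewrite hornerD hornerN !hornerM hornerC !prodE.
have tcirc z : modulus (z - z0) = tau ->
    modulus t.[z] <= (b ^+ M + 1) / (3 / 4 * tau) ^+ n * modulus s.[z].
  move=> zt; have zt' : modulus (z - z0) <= tau by rewrite zt.
  have ge : (3 / 4 * tau) ^+ n <= modulus (\prod_(x <- zs) (z - x)).
    apply: prod_XsubC_ge; first lra.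
    by move=> x /zst; have := modulus_triangle x z z0; rewrite zt; lra.
  have p0 : 0 < (3 / 4 * tau) ^+ n by rewrite exprn_gt0//; lra.
  rewrite mulrAC ler_pdivlMr//.
  apply: (@le_trans _ _ (modulus t.[z] * modulus (\prod_(x <- zs) (z - x)))).
    by rewrite ler_wpM2l ?modulus_ge0.
  rewrite -modulusM -EE (le_trans (modulusD _ _))// modulusN modulusM mulrDl.
  apply: lerD.
    rewrite ler_wpM2r ?modulus_ge0// (le_trans (prod_XsubC_le b0 _))//.
      by move=> x xl; exact: lrb.
    by rewrite ler_weXn2l.
  rewrite (le_trans (sa z zt'))// ler_wpM2r ?modulus_ge0//.
  have : c ^+ M <= 1 by rewrite exprn_ile1// ltW.
  lra.
have tdisc := rational_max_modulus tau0 s0 tcirc.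
have [z1 [z1t z1l]] := @disc_avoid R lr z0 (tau / 4) ltac:(lra).
have z1tau : modulus (z1 - z0) <= tau by lra.
have lo : c ^+ M <= modulus (\prod_(x <- lr) (z1 - x)).
  apply: (@le_trans _ _ (c ^+ size lr)).
    by apply: ler_wiXn2l => //; rewrite ltW.
  apply: prod_XsubC_ge; first exact: ltW.
  move=> x /z1l; apply: le_trans; rewrite ge_min; apply/orP; right.
  rewrite ler_pM2l; last lra.
  by rewrite lef_pV2 ?posrE ?exprn_gt0// ler_weXn2l//; lra.
have ms0 : 0 < modulus s.[z1] by rewrite modulus_gt0 s0.
have h1 : c ^+ M / 2 * modulus s.[z1] <= modulus (t.[z1] * \prod_(x <- zs) (z1 - x)).
  rewrite -EE; apply: le_trans (modulusB _ _); rewrite modulusM.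
  have := sa z1 z1tau.
  have : c ^+ M * modulus s.[z1] <= modulus (\prod_(x <- lr) (z1 - x)) * modulus s.[z1].
    by rewrite ler_wpM2r// ltW.
  lra.
have h2 : modulus (\prod_(x <- zs) (z1 - x)) <= (tau / 2) ^+ n.
  apply: prod_XsubC_le; first lra.
  by move=> x /zst xz; have := modulus_triangle z0 z1 x; rewrite (modulusBC z0); lra.
have h3 : modulus (t.[z1] * \prod_(x <- zs) (z1 - x)) <=
   (b ^+ M + 1) * (2 / 3) ^+ n * modulus s.[z1].
  rewrite modulusM; apply: (@le_trans _ _ ((b ^+ M + 1) / (3 / 4 * tau) ^+ n * modulus s.[z1] * (tau / 2) ^+ n)).
    by rewrite ler_pM ?modulus_ge0// tdisc.
  rewrite le_eqVlt; apply/orP; left; apply/eqP.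
  have -> : (2 / 3) ^+ n = ((3 / 4 * tau) ^+ n)^-1 * (tau / 2) ^+ n.
    by rewrite -exprVn -exprMn; congr (_ ^+ _); field; rewrite gt_eqF.
  by rewrite [LHS]mulrAC !mulrA.
rewrite ler_pdivrMr// [leRHS]mulrC -(ler_pM2r ms0).
exact: le_trans h1 h3.
Qed.

End counting.

(** * Measures of minimal energy *)

Section measure_probability.
Context d (T : measurableType d) (R : realType) (m : {measure set T -> \bar R}).

(** An alias of [m] indexed by the proof that its mass is 1, to which the structure of a probability
    is attached. *)
Definition measure_probability (_ : m setT = 1%E) : set T -> \bar R := m.

Variable m1 : m setT = 1%E.

HB.instance Definition _ := isMeasure.Build _ _ _ (measure_probability m1)
  (measure0 m) (measure_ge0 m) (@measure_semi_sigma_additive _ _ _ m).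
HB.instance Definition _ :=
  Measure_isProbability.Build _ _ _ (measure_probability m1) m1.

End measure_probability.

Section reweighting.
Context d (T : measurableType d) (R : realType).
Variable mu : probability T R.
Local Open Scope ereal_scope.

Lemma ge0_integral_mrestr (B : set T) (mB : measurable B) (f : T -> \bar R) :
  (forall x, 0 <= f x) -> measurable_fun setT f ->
  \int[mrestr mu mB]_x f x = \int[mu]_(x in B) f x.
Proof.
move=> f0 mf; transitivity (\int[mrestr mu mB]_(x in B) f x).
  rewrite (@ge0_negligible_integral _ _ _ _ setT (~` B))//; first by rewrite setTD setCK.
    exact: measurableC.
  by transitivity (mu (~` B `&` B)) => //; rewrite setICl measure0.
by apply: eq_measure_integral => A mA AB; transitivity (mu (A `&` B)) => //; rewrite setIidl.
Qed.

(* The density of the new measure with respect to mu is x off B and y on B. *)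
Lemma exists_reweight (B : set T) (x y : R) : measurable B ->
  (0 <= x)%R -> (0 <= y)%R -> x%:E * mu (~` B) + y%:E * mu B = 1 ->
  exists nu : probability T R,
  (forall A, measurable A -> nu A = x%:E * mu (A `&` ~` B) + y%:E * mu (A `&` B)) /\
  forall f : T -> \bar R, (forall z, 0 <= f z) -> measurable_fun setT f ->
    \int[nu]_z f z = x%:E * \int[mu]_(z in ~` B) f z + y%:E * \int[mu]_(z in B) f z.
Proof.
move=> mB x0 y0 tot.
have mBc : measurable (~` B) by exact: measurableC.
pose nu0 := measure_add (mscale (NngNum x0) (mrestr mu mBc)) (mscale (NngNum y0) (mrestr mu mB)).
have nuE A : nu0 A = x%:E * mu (A `&` ~` B) + y%:E * mu (A `&` B).
  by rewrite /nu0 measure_addE /= /mscale/= /mrestr.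
have nu1 : nu0 setT = 1 by rewrite nuE !setTI.
pose nu : probability T R := measure_probability nu1.
exists nu; split => [A mA|f f0 mf]; first exact: nuE.
rewrite -(ge0_integral_mrestr mB f0 mf) -(ge0_integral_mrestr mBc f0 mf).
transitivity (\int[nu0]_z f z); first by apply: eq_measure_integral.
rewrite ge0_integral_measure_add//.
by rewrite !ge0_integral_mscale//=.
Qed.

(** Tonelli's theorem for the restrictions of [mu] to [A] and [B], which are finite measures. It
    identifies the two mutual energies of these restrictions. *)
Lemma ge0_fubini_restr (A B : set T) (mA : measurable A) (mB : measurable B)
    (k : T * T -> \bar R) :
  (forall p, 0 <= k p) -> measurable_fun setT k ->
  \int[mu]_(x in A) \int[mu]_(y in B) k (x, y) =
  \int[mu]_(y in B) \int[mu]_(x in A) k (x, y).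
Proof.
move=> k0 mk.
have mk1 x : measurable_fun setT (fun y => k (x, y)).
  by apply: measurableT_comp => //; exact: measurable_pair1.
have mk2 y : measurable_fun setT (fun x => k (x, y)).
  by apply: measurableT_comp => //; exact: measurable_pair2.
pose mA' := mrestr mu mA : {finite_measure set T -> \bar R}.
pose mB' := mrestr mu mB : {finite_measure set T -> \bar R}.
transitivity (\int[mA']_x \int[mB']_y k (x, y)).
  rewrite ge0_integral_mrestr.
  - by apply: eq_integral => x _; rewrite ge0_integral_mrestr.
  - by move=> x; exact: integral_ge0.
  - exact: (measurable_fun_fubini_tonelli_F _ mk).
rewrite fubini_tonelli// ge0_integral_mrestr.
- by apply: eq_integral => x _; rewrite ge0_integral_mrestr.
- by move=> x; exact: integral_ge0.
- exact: (measurable_fun_fubini_tonelli_G _ mk).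
Qed.

End reweighting.

(* The left-hand side is the energy after reweighting a measure by 1 + t b off a
   set B of mass b and by 1 + t b - t on B, where e11, e12, e22 are the energies
   and mutual energy of its restrictions to the complement of B and to B. *)
Lemma first_variation (R : realFieldType) (e11 e12 e22 e b : R) :
  0 < e -> 0 <= e11 -> 0 <= e12 -> 0 <= e22 -> 0 < b -> b <= 1 ->
  (e11 + e12 + (e12 + e22) + e) * b <= e12 + e22 ->
  exists t, [/\ 0 < t, 0 <= 1 + t * b, 0 <= 1 + t * b - t &
   (1 + t * b) * ((1 + t * b) * e11 + (1 + t * b - t) * e12) +
    (1 + t * b - t) * ((1 + t * b) * e12 + (1 + t * b - t) * e22) <
   e11 + e12 + (e12 + e22)].
Proof.
move=> e0 p11 p12 p22 b0 b1 low.
pose Er := e11 + e12 + (e12 + e22).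
have Er0 : 0 <= Er by rewrite /Er; lra.
have Er1 : 0 < Er + 1 by lra.
(* The linear term in t is at most - 2 t b e and the quadratic one at most t^2 Er; since t (Er + 1)
   <= b e, the linear term wins. The bound t <= 1 keeps the weight on B nonnegative. *)
pose t := Num.min 1 (b * e / (Er + 1)).
have t0 : 0 < t by rewrite lt_min ltr01 divr_gt0 ?mulr_gt0.
have t1 : t <= 1 by rewrite ge_min lexx.
have tE : t * (Er + 1) <= b * e.
  by rewrite -ler_pdivlMr// ge_min lexx orbT.
have tb : 0 <= t * b by rewrite mulr_ge0// ltW.
exists t; split => //; [by lra|by lra|].
rewrite -/Er; move: t t0 t1 tE tb => t t0 t1 tE tb.
have -> : (1 + t * b) * ((1 + t * b) * e11 + (1 + t * b - t) * e12) +
    (1 + t * b - t) * ((1 + t * b) * e12 + (1 + t * b - t) * e22) =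
  Er + 2 * t * (Er * b - (e12 + e22)) + t ^+ 2 * (b ^+ 2 * e11 - 2 * (b * (1 - b)) * e12 + (1 - b) ^+ 2 * e22).
  by rewrite /Er; ring.
have q1 : b ^+ 2 * e11 - 2 * (b * (1 - b)) * e12 + (1 - b) ^+ 2 * e22 <= Er.
  have b2 : b ^+ 2 <= 1 by rewrite exprn_ile1// ltW.
  have c2 : (1 - b) ^+ 2 <= 1 by rewrite exprn_ile1//; lra.
  have h1 : b ^+ 2 * e11 <= e11 by rewrite ler_piMl.
  have h2 : (1 - b) ^+ 2 * e22 <= e22 by rewrite ler_piMl.
  have h3 : 0 <= 2 * (b * (1 - b)) * e12 by rewrite !mulr_ge0//; lra.
  rewrite /Er; lra.
have q2 : 2 * t * (Er * b - (e12 + e22)) <= - 2 * (t * (b * e)).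
  have : Er * b - (e12 + e22) <= - (b * e) by move: low; rewrite -/Er mulrDl; lra.
  move=> /(ler_wpM2l (ltW t0)); lra.
have q3 : t ^+ 2 * (b ^+ 2 * e11 - 2 * (b * (1 - b)) * e12 + (1 - b) ^+ 2 * e22) <= t * (t * Er).
  by rewrite [leRHS]mulrA -[t * t]expr2 ler_wpM2l// exprn_ge0// ltW.
have q4 : t * (t * (Er + 1)) <= t * (b * e) by rewrite ler_pM2l.
have q5 : 0 < t * (b * e) by rewrite !mulr_gt0.
have q6 : 0 < t * t by rewrite mulr_gt0.
have q7 : t * (t * (Er + 1)) = t * (t * Er) + t * t by ring.
move: q2 q3 q4 q5 q6; rewrite q7.
set w := t * (b * e); set v := t * (t * Er); lra.
Qed.

(** * Potentials of energy minimizers *)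

Section minimal_energy.
Context d (T : measurableType d) (R : realType).
Variables (mu : probability T R) (k : T * T -> \bar R).
Local Open Scope ereal_scope.
Hypotheses (k0 : forall p, 0 <= k p) (mk : measurable_fun setT k).
Hypothesis ksym : forall x y, k (x, y) = k (y, x).

Let P (nu : probability T R) x := \int[nu]_y k (x, y).
Let E (nu : probability T R) := \int[nu]_x P nu x.

(** The competitors are absolutely continuous with respect to [mu], as reweightings of [mu] are. For
    the equilibrium measure this guarantees that they are still carried by K. *)
Hypothesis Emin : forall nu : probability T R,
  (forall A, measurable A -> mu A = 0 -> nu A = 0) -> E mu <= E nu.
Hypothesis Efin : E mu < +oo.

Let mk1 x : measurable_fun setT (fun y => k (x, y)).
Proof. by apply: measurableT_comp => //; exact: measurable_pair1. Qed.

Let mP B : measurable B -> measurable_fun setT (fun x => \int[mu]_(y in B) k (x, y)).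
Proof.
move=> mB; rewrite (_ : (fun _ => _) = (fun x => \int[mrestr mu mB]_y k (x, y))).
  exact: (measurable_fun_fubini_tonelli_F _ mk).
by apply/funext => x; rewrite ge0_integral_mrestr.
Qed.

(* First variation: the potential of an energy minimizer cannot exceed the
   energy on a set of positive measure, since shifting mass away from it would
   lower the energy. *)
Lemma potential_le_minimal_energy (e : R) : (0 < e)%R ->
  mu [set x | E mu + e%:E <= P mu x] = 0.
Proof.
move=> e0; set B := [set x | _ <= _].
have mB : measurable B.
  rewrite /B -[X in measurable X]setTI; apply: measurable_lee => //.
  exact: (measurable_fun_fubini_tonelli_F _ mk).
have mBc : measurable (~` B) by exact: measurableC.
have Pge0 (A : set T) x : 0 <= \int[mu]_(y in A) k (x, y) by exact: integral_ge0.
pose P1 x := \int[mu]_(y in ~` B) k (x, y).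
pose P2 x := \int[mu]_(y in B) k (x, y).
have P10 x : 0 <= P1 x by exact: Pge0.
have P20 x : 0 <= P2 x by exact: Pge0.
have split (f : T -> \bar R) : (forall x, 0 <= f x) -> measurable_fun setT f ->
    \int[mu]_x f x = \int[mu]_(x in ~` B) f x + \int[mu]_(x in B) f x.
  move=> f0 mf; rewrite -(setvU B) ge0_integral_setU//; first by rewrite setvU.
  by rewrite disj_set2E setICl.
have PE x : P mu x = P1 x + P2 x by exact: split.
have [E11 dE11] : exists a, a = \int[mu]_(x in ~` B) P1 x by exists (\int[mu]_(x in ~` B) P1 x).
have [E12 dE12] : exists a, a = \int[mu]_(x in ~` B) P2 x by exists (\int[mu]_(x in ~` B) P2 x).
have [E21 dE21] : exists a, a = \int[mu]_(x in B) P1 x by exists (\int[mu]_(x in B) P1 x).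
have [E22 dE22] : exists a, a = \int[mu]_(x in B) P2 x by exists (\int[mu]_(x in B) P2 x).
have mPB A : measurable A -> measurable_fun A P1 /\ measurable_fun A P2.
  by move=> mA; split; apply: measurable_funTS; exact: mP.
have EE : E mu = E11 + E12 + (E21 + E22).
  rewrite /E (eq_integral (fun x => P1 x + P2 x)); last by move=> x _; exact: PE.
  rewrite split; last 2 first.
  - by move=> x; apply: adde_ge0; exact: Pge0.
  - by apply: emeasurable_funD; exact: mP.
  have [? ?] := mPB _ mB; have [? ?] := mPB _ mBc.
  by rewrite dE11 dE12 dE21 dE22; congr (_ + _); apply: ge0_integralD.
have E12E21 : E12 = E21.
  rewrite dE12 dE21; apply: (etrans (ge0_fubini_restr mu mBc mB k0 mk)).
  by apply: eq_integral => y _; apply: eq_integral => x _; exact: ksym.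
have E0 : [/\ 0 <= E11, 0 <= E12, 0 <= E21 & 0 <= E22].
  by rewrite dE11 dE12 dE21 dE22; split; apply: integral_ge0 => x _; exact: Pge0.
have [e11_0 e12_0 e21_0 e22_0] := E0.
have fin x : 0 <= x -> x <= E mu -> x \is a fin_num.
  by move=> x0 xE; rewrite ge0_fin_numE// (le_lt_trans xE).
have s22 : 0 <= E21 + E22 by exact: adde_ge0.
have s12 : 0 <= E11 + E12 by exact: adde_ge0.
have f11 : E11 \is a fin_num.
  by apply: fin => //; rewrite EE -addeA leeDl//; exact: adde_ge0.
have f12 : E12 \is a fin_num.
  by apply: fin => //; rewrite EE addeAC leeDr//; exact: adde_ge0.
have f22 : E22 \is a fin_num.
  by apply: fin => //; rewrite EE addeA leeDr//; exact: adde_ge0.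
have lowB : (E mu + e%:E) * mu B <= E21 + E22.
  have [m1 m2] := mPB _ mB.
  rewrite dE21 dE22 -integral_cst// -ge0_integralD//.
  apply: ge0_le_integral => //.
  - move=> x _; apply: adde_ge0; last by rewrite lee_fin ltW.
    by rewrite EE; exact: adde_ge0.
  - exact: emeasurable_funD.
  - by move=> x; rewrite /B/= => Bx; rewrite -PE.
have [//|muB] := eqVneq (mu B) 0; exfalso.
have fB : mu B \is a fin_num by exact: fin_num_measure.
have b0' : (0 < fine (mu B))%R by rewrite fine_gt0// lt0e muB measure_ge0/= ltey_eq fB.
have b1' : (fine (mu B) <= 1)%R by rewrite -lee_fin fineK// probability_le1.
have fBc : mu (~` B) = (1 - fine (mu B))%:E.
  by rewrite EFinB fineK// probability_setC.
pose e11 := fine E11; pose e12 := fine E12; pose e22 := fine E22.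
have [b bE] : exists b, b = fine (mu B) by exists (fine (mu B)).
have b0 : (0 < b)%R by rewrite bE.
have b1 : (b <= 1)%R by rewrite bE.
have fE : E mu = (e11 + e12 + (e12 + e22))%:E.
  by rewrite EE -E12E21 !EFinD !fineK.
have low : ((e11 + e12 + (e12 + e22) + e) * b <= e12 + e22)%R.
  by move: lowB; rewrite fE -E12E21 -(fineK f12) -(fineK f22) -(fineK fB) -!EFinD -EFinM lee_fin bE.
have p11 : (0 <= e11)%R by rewrite fine_ge0.
have p12 : (0 <= e12)%R by rewrite fine_ge0.
have p22 : (0 <= e22)%R by rewrite fine_ge0.
have [t [t0 x0 y0 tlt]] := first_variation e0 p11 p12 p22 b0 b1 low.
have [|nu [nuE nuI]] := @exists_reweight _ _ _ mu B _ _ mB x0 y0.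
  rewrite fBc -[mu B](fineK fB) /= -bE -!EFinM -EFinD; congr EFin.
  by move: b t {x0 y0 t0 tlt low b0 b1 bE} => b t; ring.
have nuac A : measurable A -> mu A = 0 -> nu A = 0.
  move=> mA muA0; rewrite nuE//.
  rewrite !(subset_measure0 _ _ _ muA0) ?mule0 ?adde0//; exact: measurableI.
have := Emin nuac; apply/negP; rewrite -ltNge.
have Pnu z : P nu z = (1 + t * b)%:E * P1 z + (1 + t * b - t)%:E * P2 z.
  by rewrite /P nuI.
have Enu : E nu = ((1 + t * b) * ((1 + t * b) * e11 + (1 + t * b - t) * e12) +
    (1 + t * b - t) * ((1 + t * b) * e12 + (1 + t * b - t) * e22))%:E.
  have lin A : measurable A -> \int[mu]_(z in A) P nu z =
     (1 + t * b)%:E * (\int[mu]_(z in A) P1 z) + (1 + t * b - t)%:E * \int[mu]_(z in A) P2 z.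
    move=> mA; have [m1 m2] := mPB _ mA.
    under eq_integral do rewrite Pnu.
    rewrite ge0_integralD//; last 4 first.
    - by move=> z _; rewrite mule_ge0// lee_fin.
    - exact: measurable_funeM.
    - by move=> z _; rewrite mule_ge0// lee_fin.
    - exact: measurable_funeM.
    by rewrite !ge0_integralZl_EFin.
  have mPnu : measurable_fun setT (P nu) by exact: (measurable_fun_fubini_tonelli_F _ mk).
  have Pnu0 z : 0 <= P nu z by exact: integral_ge0.
  rewrite [LHS](nuI _ Pnu0 mPnu).
  rewrite !lin// -dE11 -dE12 -dE21 -dE22 -E12E21.
  by rewrite -(fineK f11) -(fineK f12) -(fineK f22) -?EFinM -?EFinD -?EFinM -?EFinD /e11 /e12 /e22.
by rewrite Enu fE lte_fin.
Qed.

(** The exceptional set is the countable union of the null sets where the potential is at least E mu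
    + 1/(n+1). *)
Lemma potential_le_minimal_energy_ae : mu [set x | P mu x <= E mu] = 1.
Proof.
have mPmu : measurable_fun setT (P mu) by exact: (measurable_fun_fubini_tonelli_F _ mk).
have mS : measurable [set x | P mu x <= E mu].
  by rewrite -[X in measurable X]setTI; apply: measurable_lee.
rewrite -[X in mu X]setCK probability_setC ?measurableC//; last exact: measurableC.
suff -> : mu (~` [set x | P mu x <= E mu]) = 0 by rewrite sube0.
apply: measure_negligible; first exact: measurableC.
apply: (@negligibleS _ _ _ mu (\bigcup_n [set x | E mu + (n.+1%:R^-1)%:E <= P mu x])).
  move=> x /negP; rewrite -ltNge => xE.
  have Ef : E mu \is a fin_num.
    by rewrite ge0_fin_numE//; do 2 apply: integral_ge0 => ? _.
  move: xE; rewrite -(fineK Ef); case PE: (P mu x) => [r| |]//; last first.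
    by move=> _; exists 0%N => //=; rewrite PE leey.
  rewrite lte_fin -subr_gt0 => h.
  exists (Num.trunc (r - fine (E mu))^-1) => //=; rewrite PE -(fineK Ef) -EFinD lee_fin -lerBrDl.
  rewrite invf_ple ?posrE// ltW// truncnS_gt//.
apply: negligible_bigcup => n; apply/negligibleP.
  rewrite -[X in measurable X]setTI; apply: measurable_lee => //.
exact: potential_le_minimal_energy.
Qed.
End minimal_energy.

(** * Borel measurability of log |z - w| *)

Section borel.
Variable R : realType.
Implicit Types (x y z w h u : Cplx R).

Lemma measurable_openC (O : set (Cplx R)) : open O -> measurable (O : set (borelC R)).
Proof. by move=> oO; apply: sub_sigma_algebra. Qed.

Lemma measurable_closedC (A : set (Cplx R)) : closed A -> measurable (A : set (borelC R)).
Proof.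
move=> cA; rewrite -[A]setCK; apply: measurableC.
by apply: measurable_openC; exact: closed_openC.
Qed.

Lemma continuous_on_open_measurable (O A : set (Cplx R)) (f : Cplx R -> R) :
  open O -> measurable (A : set (borelC R)) -> A `<=` O ->
  (forall z, O z -> {for z, continuous f}) ->
  measurable_fun (A : set (borelC R)) (f : borelC R -> R).
Proof.
move=> oO mA AO fc; apply: (measurability _ (RGenOpens.measurableE R)).
move=> _ [_ [a [b ->] <-]]; set U := [set` _].
have oU : open U by exact: interval_open.
have -> : A `&` f @^-1` U = A `&` (O `&` f @^-1` U).
  by apply/seteqP; split => z [Az]; [move=> ?; split => //; split => //; exact: AO|case].
have mO : measurable (O `&` f @^-1` U : set (borelC R)).
  apply: measurable_openC; rewrite openE => z [Oz fz]; apply: filterI.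
    by move: oO; rewrite openE => /(_ z Oz).
  by apply: (fc z Oz); move: oU; rewrite openE => /(_ _ fz).
exact: measurableI mA mO.
Qed.

Lemma continuous_measurableC (f : Cplx R -> R) : continuous f ->
  measurable_fun setT (f : borelC R -> R).
Proof.
move=> fc; apply: (@continuous_on_open_measurable setT) => //; first exact: openT.
by move=> z _; exact: fc.
Qed.

(** Pairs carry the product sigma-algebra; real and imaginary parts reduce the claim to continuous
    functions of one variable each. *)
Lemma measurable_modulusB :
  measurable_fun setT (fun p : borelC R * borelC R => modulus ((p.1 : Cplx R) - p.2)).
Proof.
rewrite (_ : (fun _ => _) = (fun p : borelC R * borelC R =>
  Num.sqrt ((complex.Re (p.1 : Cplx R) - complex.Re (p.2 : Cplx R)) ^+ 2 +
            (complex.Im (p.1 : Cplx R) - complex.Im (p.2 : Cplx R)) ^+ 2))); last first.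
  by apply/funext => -[[a b] [c d]]; rewrite modulusE.
have mre : measurable_fun setT (@complex.Re R : borelC R -> R).
  exact: continuous_measurableC (@Re_continuous R).
have mim : measurable_fun setT (@complex.Im R : borelC R -> R).
  exact: continuous_measurableC (@Im_continuous R).
apply: measurableT_comp; first exact: (continuous_measurable_fun (@sqrt_continuous R)).
apply: measurable_funD; apply: measurable_funX; apply: measurable_funB.
- by apply: measurableT_comp => //; exact: measurable_fst.
- by apply: measurableT_comp => //; exact: measurable_snd.
- by apply: measurableT_comp => //; exact: measurable_fst.
- by apply: measurableT_comp => //; exact: measurable_snd.
Qed.

Lemma measurable_lne : measurable_fun setT (fun r : R => lne r%:E).
Proof.
rewrite /lne; apply: measurable_fun_ifT => //.
  exact: measurable_fun_ler.
by apply/measurable_EFinP; exact: measurable_ln.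
Qed.

Lemma measurable_log_modB :
  measurable_fun setT (fun p : borelC R * borelC R => log_mod ((p.1 : Cplx R) - p.2)).
Proof. by apply: (measurableT_comp measurable_lne); exact: measurable_modulusB. Qed.

Lemma log_modE z : z != 0 -> log_mod z = (ln (modulus z))%:E.
Proof. by move=> z0; rewrite /log_mod lne_EFin// modulus_gt0. Qed.

Lemma log_mod0 : log_mod (0 : Cplx R) = -oo%E.
Proof. by rewrite /log_mod modulus0 /= lexx. Qed.

End borel.

Section integral_cB.
Context d (T : measurableType d) (R : realType) (mu : probability T R).
Local Open Scope ereal_scope.

(* No integrability is assumed: both sides are -oo when the integral of k is +oo. *)
Lemma integral_cst_sub_ge0 (f k : T -> \bar R) (c : R) :
  measurable_fun setT f -> measurable_fun setT k -> (forall x, 0 <= k x) ->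
  {ae mu, forall x, f x = c%:E - k x} ->
  \int[mu]_x f x = c%:E - \int[mu]_x k x.
Proof.
move=> mf mk k0 fE.
pose h x := c%:E - k x.
have mh : measurable_fun setT h by exact: emeasurable_funB.
transitivity (\int[mu]_x h x).
  by apply: ae_eq_integral => //; apply: filterS fE => x + _.
rewrite integralE.
have mhp : measurable_fun setT h^\+ by exact: measurable_funepos.
have mhn : measurable_fun setT h^\- by exact: measurable_funeneg.
pose cp := (Num.max c 0)%:E : \bar R; pose cn := (Num.max (- c) 0)%:E : \bar R.
have cp0 : 0 <= cp by rewrite lee_fin le_max lexx orbT.
have cn0 : 0 <= cn by rewrite lee_fin le_max lexx orbT.
(* The identity h = c - k, rearranged so that only nonnegative functions are added: it stays valid
   where k = +oo and can be integrated term by term. The bound of h^+ by [cp] then makes its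
   integral finite, so that the result can be rearranged back. *)
have pw x : h^\+ x + (k x + cn) = h^\- x + cp.
  rewrite funeposE funenegE /h /cp /cn; case: (k x) (k0 x) => [r| |]//= r0.
    rewrite -EFinB -!EFin_max -!EFinD; congr EFin.
    by rewrite /Num.max; do 4 case: ifPn; lra.
  by rewrite maxNye/= add0e.
have icst r : \int[mu]_x (cst r x) = r.
  by rewrite integral_cst// -[RHS]mule1; congr (_ * _); exact: probability_setT.
have : \int[mu]_x h^\+ x + (\int[mu]_x k x + cn) = \int[mu]_x h^\- x + cp.
  transitivity (\int[mu]_x (h^\+ x + (k x + cn))).
    rewrite ge0_integralD//; last 2 first.
    - by move=> x _; rewrite adde_ge0.
    - by apply: emeasurable_funD.
    by rewrite ge0_integralD// (icst cn).
  rewrite (eq_integral (fun x => h^\- x + cp)); last by move=> x _; exact: pw.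
  by rewrite ge0_integralD// (icst cp).
have hp0 : 0 <= \int[mu]_x h^\+ x by exact: integral_ge0.
have hn0 : 0 <= \int[mu]_x h^\- x by exact: integral_ge0.
have hpc : \int[mu]_x h^\+ x <= cp.
  rewrite -[leRHS]icst.
  apply: ge0_le_integral => // x _.
  rewrite funeposE /h /cp /=; case: (k x) (k0 x) => [r| |]//= r0.
    by rewrite -EFinB -EFin_max lee_fin /Num.max; do 2 case: ifPn; move: r0; rewrite lee_fin; lra.
  by rewrite maxNye.
have ik0 : 0 <= \int[mu]_x k x by exact: integral_ge0.
move: (\int[mu]_x h^\+ x) (\int[mu]_x h^\- x) (\int[mu]_x k x) hp0 hn0 hpc ik0.
move=> [p| |]// [n| |]// [r| |]//=; rewrite /cp /cn ?lee_fin => p0 n0 pc r0 //.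
move/eqP; rewrite -!EFinD eqe => /eqP E.
congr EFin; move: E.
by rewrite /Num.max; do 2 case: ifPn; lra.
Qed.
End integral_cB.

(** * Logarithmic potentials and Frostman's theorem *)

Section log_potential.
Variables (R : realType) (omega : probability (borelC R) R).
Implicit Types (x y z w h u : Cplx R).

Definition separated_by (S : set (Cplx R)) z (e : R) :=
  forall w, S w -> e <= modulus (z - w).

(** Real-valued counterpart of [potential] on a carrier [S]. It is meant for points at positive
    distance from a bounded [S], where the integrand is bounded and the two agree by
    [potentialE]. *)
Definition log_potential (S : set (Cplx R)) z : R :=
  Rintegral omega (S : set (borelC R)) (fun w : borelC R => ln (modulus (z - (w : Cplx R)))).

Variables (S : set (Cplx R)) (B : R).
Hypothesis mS : measurable (S : set (borelC R)).
Hypothesis S1 : omega (S : set (borelC R)) = 1%E.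
Hypothesis SB : forall w, S w -> modulus w < B.

Lemma bounded_integrableC (f : Cplx R -> R) (M : R) :
  measurable_fun (S : set (borelC R)) (f : borelC R -> R) ->
  (forall w, S w -> `|f w| <= M) ->
  omega.-integrable (S : set (borelC R)) (EFin \o (f : borelC R -> R)).
Proof.
move=> mf fM; apply: measurable_bounded_integrable => //.
  by apply: (@le_lt_trans _ _ 1%E); [exact: probability_le1|exact: ltry].
exists M; split; first exact: num_real.
by move=> x Mx w Sw; apply: le_trans (fM w Sw) _; exact: ltW.
Qed.

Lemma Rintegral_cstC (c : R) : Rintegral omega (S : set (borelC R)) (fun=> c) = c.
Proof.
rewrite Rintegral_cst// -[RHS]mulr1; congr (_ * _).
by transitivity (fine (1%E : \bar R)) => //; congr fine.
Qed.

Lemma Rintegral_boundC (f : Cplx R -> R) (M : R) :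
  measurable_fun (S : set (borelC R)) (f : borelC R -> R) ->
  (forall w, S w -> `|f w| <= M) ->
  `|Rintegral omega (S : set (borelC R)) (f : borelC R -> R)| <= M.
Proof.
move=> mf fM; have fi := bounded_integrableC mf fM.
rewrite (le_trans (le_normr_Rintegral _ _))//.
rewrite -[leRHS]Rintegral_cstC; apply: le_Rintegral => //.
  by have := integrable_norm fi.
apply: (@bounded_integrableC (fun=> M) `|M|) => //.
Qed.

Lemma measurable_ln_modulusB z :
  measurable_fun setT (fun w : borelC R => ln (modulus (z - (w : Cplx R)))).
Proof.
apply: (measurableT_comp (@measurable_ln R)).
exact: (measurableT_comp (@measurable_modulusB R) (@measurable_pair1 _ _ (borelC R) (borelC R) z)).
Qed.

Lemma ln_modulus_bound z e w : 0 < e -> separated_by S z e -> S w ->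
  `|ln (modulus (z - w))| <= `|ln e| + `|ln (modulus z + B)|.
Proof.
move=> e0 zS Sw; have ez := zS w Sw.
have zw0 : 0 < modulus (z - w) by exact: lt_le_trans ez.
have zB : modulus (z - w) <= modulus z + B.
  by rewrite (le_trans (modulusD _ _))// modulusN lerD2l ltW// SB.
have l1 : ln e <= ln (modulus (z - w)) by rewrite ler_ln ?posrE.
have l2 : ln (modulus (z - w)) <= ln (modulus z + B).
  by rewrite ler_ln ?posrE// (lt_le_trans zw0).
have := ler_norm (ln (modulus z + B)); have := ler_norm (- ln e); rewrite normrN.
have := normr_ge0 (ln e); have := normr_ge0 (ln (modulus z + B)).
by move=> *; rewrite ler_norml; apply/andP; split; lra.
Qed.

Lemma log_potential_integrable z e : 0 < e -> separated_by S z e ->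
  omega.-integrable (S : set (borelC R))
    (EFin \o (fun w : borelC R => ln (modulus (z - (w : Cplx R))))).
Proof.
move=> e0 zS; apply: (bounded_integrableC (f := fun w => ln (modulus (z - w)))).
  exact: measurable_funTS (measurable_ln_modulusB z).
by move=> w; exact: ln_modulus_bound e0 zS.
Qed.

Lemma ae_carrier (P : Cplx R -> Prop) : (forall w, S w -> P w) ->
  {ae omega, forall w : borelC R, P w}.
Proof.
move=> SP; exists (~` (S : set (borelC R))); split.
- exact: measurableC.
- by have := probability_setC omega mS; rewrite S1 subee.
- by move=> w /= Pw Sw; exact/Pw/SP.
Qed.

Lemma potentialE z e : 0 < e -> separated_by S z e ->
  potential omega z = (log_potential S z)%:E.
Proof.
move=> e0 zS.
have mlog : measurable_fun setT (fun w : borelC R => log_mod (z - (w : Cplx R))).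
  exact: (measurableT_comp (@measurable_log_modB R) (@measurable_pair1 _ _ (borelC R) (borelC R) z)).
have int := log_potential_integrable e0 zS.
rewrite /log_potential /Rintegral fineK; last exact: integrable_fin_num.
rewrite /potential [RHS]integral_mkcond.
apply: (@ae_eq_integral _ (borelC R) R omega setT) => //.
  apply: (measurable_restrictT _ mS).1; apply: measurable_funTS.
  by apply/measurable_EFinP; exact: measurable_ln_modulusB.
apply: (ae_carrier (P := fun w => True -> _)) => w Sw _.
rewrite patchE mem_set//= log_modE//.
by rewrite -modulus_gt0 (lt_le_trans e0)// zS.
Qed.

Lemma separated_by_shift z h e : separated_by S z e -> modulus h <= e / 2 ->
  separated_by S (z + h) (e / 2).
Proof.
move=> zS he w /zS; have := modulusB (z - w) (- h).
by rewrite modulusN opprK addrAC; lra.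
Qed.

(** Order 0 of [ln_modulus_taylor] at - h / (z - w), of modulus at most |h| / e <= 1/2. *)
Lemma ln_modulus_shift z h w e : 0 < e -> e <= modulus (z - w) ->
  modulus h <= e / 2 ->
  `|ln (modulus (z + h - w)) - ln (modulus (z - w))| <= 2 * modulus h / e.
Proof.
move=> e0 ez he.
have zw0 : 0 < modulus (z - w) by exact: lt_le_trans ez.
have zwn0 : z - w != 0 by rewrite -modulus_gt0.
have x2 : modulus (- h / (z - w)) <= modulus h / e.
  rewrite modulusM modulusN modulusV ler_wpM2l ?modulus_ge0//.
  by rewrite lef_pV2 ?posrE.
have x2' : modulus (- h / (z - w)) <= 2^-1.
  by rewrite (le_trans x2)// ler_pdivrMr//; lra.
have -> : z + h - w = (z - w) * (1 - (- h / (z - w))).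
  by rewrite mulrBr mulr1 mulrC mulfVK// opprK addrAC.
rewrite modulusM lnM ?posrE//; last first.
  by rewrite (lt_le_trans _ (modulus_sub1_ge x2')).
rewrite addrAC subrr add0r.
have := ln_modulus_taylor 0 x2'; rewrite big_ord0 addr0 expr1 => /le_trans; apply.
by rewrite -mulrA ler_pM2l.
Qed.

Lemma log_potential_shift z h e : 0 < e -> separated_by S z e -> modulus h <= e / 2 ->
  `|log_potential S (z + h) - log_potential S z| <= 2 * modulus h / e.
Proof.
move=> e0 zS he; have e20 : 0 < e / 2 by rewrite divr_gt0.
rewrite /log_potential -RintegralB//; last 2 first.
- exact: (log_potential_integrable e20 (separated_by_shift zS he)).
- exact: (log_potential_integrable e0 zS).
apply: (Rintegral_boundC (f := fun w => ln (modulus (z + h - w)) - ln (modulus (z - w)))).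
  by apply: measurable_funB; apply: measurable_funTS; exact: measurable_ln_modulusB.
by move=> w Sw; apply: ln_modulus_shift => //; exact: zS.
Qed.

Lemma log_potential_ge z e : 0 < e -> separated_by S z e -> ln e <= log_potential S z.
Proof.
move=> e0 zS; rewrite -[leLHS]Rintegral_cstC; apply: le_Rintegral => //.
- by apply: (@bounded_integrableC (fun=> ln e) `|ln e|).
- exact: log_potential_integrable e0 zS.
- by move=> w Sw; rewrite ler_ln ?posrE ?zS// (lt_le_trans e0)// zS.
Qed.

Lemma log_potential_sum z e (rs : seq (Cplx R)) : 0 < e -> separated_by S z e ->
  (forall r, r \in rs -> modulus r <= e / 2) ->
  omega.-integrable (S : set (borelC R)) (EFin \o (fun w : borelC R =>
    \sum_(r <- rs) ln (modulus (z - r - (w : Cplx R))))) /\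
  \sum_(r <- rs) log_potential S (z - r) =
  Rintegral omega (S : set (borelC R)) (fun w : borelC R =>
    \sum_(r <- rs) ln (modulus (z - r - (w : Cplx R)))).
Proof.
move=> e0 zS; have e20 : 0 < e / 2 by rewrite divr_gt0.
elim: rs => [|r rs IH] rse.
  under [X in Rintegral _ _ X]eq_fun do rewrite big_nil.
  split; last by rewrite big_nil Rintegral_cstC.
  apply: (@bounded_integrableC _ 0).
    under eq_fun do rewrite big_nil; exact: measurable_cst.
  by move=> w _; rewrite big_nil normr0.
have [|ih1 ih2] := IH; first by move=> u urs; apply: rse; rewrite inE urs orbT.
have int : omega.-integrable (S : set (borelC R)) (EFin \o (fun w : borelC R => ln (modulus (z - r - (w : Cplx R))))).
  apply: (@log_potential_integrable _ (e / 2)) => //.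
  by apply: separated_by_shift => //; rewrite modulusN rse ?mem_head.
have eqf : (fun w : borelC R => \sum_(r0 <- r :: rs) ln (modulus (z - r0 - (w : Cplx R)))) =
   (fun w : borelC R => ln (modulus (z - r - (w : Cplx R))) +
      \sum_(r0 <- rs) ln (modulus (z - r0 - (w : Cplx R)))).
  by apply/funext => w; rewrite big_cons.
rewrite eqf; split; last by rewrite big_cons ih2 RintegralD.
by apply: eq_integrable (integrableD mS int ih1).
Qed.

(** Integration of [ln_modulus_mean] at u = z - w over [S], the error being uniform in w. *)
Lemma log_potential_mean N z h e rs : (0 < N)%N -> 0 < e -> separated_by S z e ->
  modulus h <= e / 2 -> 'X^N - (h ^+ N)%:P = \prod_(r <- rs) ('X - r%:P) ->
  (forall r, r \in rs -> modulus r = modulus h) ->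
  `|\sum_(r <- rs) log_potential S (z - r) - N%:R * log_potential S z| <= 2 * 2^-1 ^+ N.
Proof.
move=> N0 e0 zS he E rsh.
have [|int ->] := @log_potential_sum z e rs e0 zS.
  by move=> r /rsh ->.
have iz := log_potential_integrable e0 zS.
rewrite -RintegralZl// -RintegralB//; last first.
  by have := integrableZl mS N%:R iz; apply: eq_integrable.
apply: (Rintegral_boundC (f := fun w => \sum_(r <- rs) ln (modulus (z - r - w)) -
  N%:R * ln (modulus (z - w)))).
  apply: measurable_funB.
    by have /integrableP[/measurable_EFinP] := int.
  by apply: measurable_funM => //; apply: measurable_funTS; exact: measurable_ln_modulusB.
move=> w Sw; have zw : z - w != 0 by rewrite -modulus_gt0 (lt_le_trans e0)// zS.
have := @ln_modulus_mean R N h (z - w) rs zw _ N0 E.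
under eq_bigr do rewrite addrAC.
by apply; rewrite (le_trans he)// ler_pM2r// zS.
Qed.

(** In [log_potential_mean] the sum of the N increments, not only their average, tends to 0. At a
    minimum all increments are nonnegative, and the one belonging to the prescribed [h] occurs for
    every N, so it is 0. *)
Lemma log_potential_min z e : 0 < e -> separated_by S z e ->
  (forall h, modulus h <= e / 2 -> log_potential S z <= log_potential S (z + h)) ->
  forall h, modulus h <= e / 2 -> log_potential S (z + h) = log_potential S z.
Proof.
move=> e0 zS zmin h he; apply/eqP; rewrite eq_le zmin// andbT -subr_le0.
apply/ler_addgt0Pr => d d0; rewrite add0r.
have [N Nd] := @geometric_small R 2^-1 (d / 2) ltac:(lra) ltac:(lra).
have nh : modulus (- h) <= e / 2 by rewrite modulusN.
have [rs [E sz hrs rsh]] := @XnsubC_roots R N.+1 (- h) isT.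
have := log_potential_mean (ltn0Sn N) e0 zS nh E rsh.
have -> : N.+1%:R * log_potential S z = \sum_(r <- rs) log_potential S z.
  by rewrite big_const_seq count_predT iter_addr_0 sz mulr_natl.
rewrite -sumrB => mean.
have rest : 0 <= \sum_(r <- rem (- h) rs) (log_potential S (z - r) - log_potential S z).
  rewrite big_seq; apply: sumr_ge0 => r /mem_rem /rsh rh.
  by rewrite subr_ge0 zmin// modulusN rh.
move: mean; rewrite (big_rem _ hrs)/= opprK => mean.
have := ler_norm (log_potential S (z + h) - log_potential S z +
  \sum_(r <- rem (- h) rs) (log_potential S (z - r) - log_potential S z)).
have := Nd N.+1 (leqnSn N); move: mean rest; lra.
Qed.

End log_potential.

Lemma probability_setI1 d (T : measurableType d) (R : realType)
    (P : probability T R) (A B : set T) : measurable A -> measurable B ->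
  P A = 1%E -> P B = 1%E -> P (A `&` B) = 1%E.
Proof.
move=> mA mB PA PB; have AB0 : P (~` (A `&` B)) = 0%E.
  apply: measure_negligible; first by apply: measurableC; exact: measurableI.
  rewrite setCI; apply: negligibleU; apply/negligibleP; do ?exact: measurableC.
    by rewrite -[RHS](@subee R 1%E)// -{2}PA; exact: probability_setC.
  by rewrite -[RHS](@subee R 1%E)// -{2}PB; exact: probability_setC.
have := probability_setC P (measurableC (measurableI _ _ mA mB)).
by rewrite setCK AB0 sube0.
Qed.

(** * Energy as the integral of a nonnegative kernel *)

Section energy.
Variables (R : realType).
Implicit Types (x y z w h u : Cplx R).

(** log (D / |x - y|) cut off at 0. On a set of diameter at most [D] the cut changes nothing, and
    energies become ln D minus integrals of a nonnegative kernel, to which Tonelli's theorem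
    applies; maximal energy becomes minimal energy. *)
Definition log_kernel (D : R) (p : borelC R * borelC R) : \bar R :=
  (maxe 0 ((ln D)%:E - log_mod ((p.1 : Cplx R) - p.2)))%E.

Lemma log_kernel_ge0 D p : (0 <= log_kernel D p)%E.
Proof. by rewrite /log_kernel le_max lexx. Qed.

Lemma measurable_log_kernel D : measurable_fun setT (log_kernel D).
Proof.
apply: measurable_maxe => //; apply: emeasurable_funB => //.
exact: measurable_log_modB.
Qed.

Lemma log_kernel_sym D x y : log_kernel D (x, y) = log_kernel D (y, x).
Proof. by rewrite /log_kernel /= /log_mod modulusBC. Qed.

Lemma log_kernelE D x y : 0 < D -> modulus (x - y) <= D ->
  (log_mod (x - y) = (ln D)%:E - log_kernel D (x, y))%E.
Proof.
move=> D0 xyD; rewrite /log_kernel /=.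
have [->|xy] := eqVneq (x - y) 0; first by rewrite log_mod0 max_r ?leey.
have h : (0 <= (ln D)%:E - (ln (modulus (x - y)))%:E)%E.
  by rewrite -EFinB lee_fin subr_ge0 ler_ln ?posrE ?modulus_gt0.
rewrite log_modE// max_r//= -?EFinB; congr EFin; ring.
Qed.

Lemma measurable_potential (nu : probability (borelC R) R) :
  measurable_fun setT (potential nu : borelC R -> \bar R).
Proof.
have ml := @measurable_log_modB R.
have -> : (potential nu : borelC R -> \bar R) = (fun z : borelC R => \int[nu]_w (fun p : borelC R * borelC R => log_mod ((p.1 : Cplx R) - p.2))^\+ (z, w)
   - \int[nu]_w (fun p : borelC R * borelC R => log_mod ((p.1 : Cplx R) - p.2))^\- (z, w))%E.
  apply/funext => z; rewrite /potential integralE; congr (_ - _)%E.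
    by apply: eq_integral => w _; rewrite !funeposE.
  by apply: eq_integral => w _; rewrite !funenegE.
apply: emeasurable_funB.
    apply: (measurable_fun_fubini_tonelli_F (m2 := nu)); first exact: measurable_funepos.
    by move=> p; exact: funepos_ge0.
  apply: (measurable_fun_fubini_tonelli_F (m2 := nu)); first exact: measurable_funeneg.
  by move=> p; exact: funeneg_ge0.
Qed.

Variables (K : set (Cplx R)) (D : R).
Hypotheses (mK : measurable (K : set (borelC R))) (D0 : 0 < D).
Hypothesis KD : forall x y, K x -> K y -> modulus (x - y) <= D.

Lemma energyE (nu : probability (borelC R) R) : prob_on K nu ->
  energy nu = ((ln D)%:E - \int[nu]_z \int[nu]_w log_kernel D (z, w))%E.
Proof.
move=> nuK; have mk := @measurable_log_kernel D.
have mk1 z : measurable_fun setT (fun w : borelC R => log_kernel D (z, w)).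
  exact: (measurableT_comp mk (@measurable_pair1 _ _ (borelC R) (borelC R) z)).
have ml1 z : measurable_fun setT (fun w : borelC R => log_mod (z - (w : Cplx R))).
  exact: (measurableT_comp (@measurable_log_modB R) (@measurable_pair1 _ _ (borelC R) (borelC R) z)).
apply: integral_cst_sub_ge0.
- exact: measurable_potential.
- by apply: (measurable_fun_fubini_tonelli_F (m2 := nu)) => // p; exact: log_kernel_ge0.
- by move=> z; apply: integral_ge0 => w _; exact: log_kernel_ge0.
- apply: (ae_carrier mK nuK (P := fun z => _)) => z Kz.
  apply: integral_cst_sub_ge0 => //; first by move=> w; exact: log_kernel_ge0.
  by apply: (ae_carrier mK nuK (P := fun z => _)) => w Kw; apply: log_kernelE => //; exact: KD.
Qed.

Variable omega : probability (borelC R) R.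
Hypotheses (Knp : non_polar K) (Komega : equilibrium_measure K omega).

(** [S] is the part of K where the kernel potential does not exceed the minimal kernel energy [e], a
    set of full measure by the first variation. The bound then holds at every point of [S]. *)
Lemma frostman_set : exists (e : R) (S : set (Cplx R)),
  [/\ energy omega = (ln D - e)%:E, S `<=` K, measurable (S : set (borelC R)),
      omega (S : set (borelC R)) = 1%E &
      forall z, S z -> (\int[omega]_w log_kernel D (z, w) <= e%:E)%E].
Proof.
have [Kom Kmax] := Komega.
have mk := @measurable_log_kernel D.
pose E (nu : probability (borelC R) R) := (\int[nu]_z \int[nu]_w log_kernel D (z, w))%E.
have E0 nu : (0 <= E nu)%E.
  by apply: integral_ge0 => z _; apply: integral_ge0 => w _; exact: log_kernel_ge0.
have Efin : (E omega < +oo)%E.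
  (* Positive capacity provides a measure of energy above -oo, and the equilibrium measure has at
     least that energy. *)
  have [mu Kmu mu0] : exists2 mu, prob_on K mu & energy mu <> -oo%E.
    have [_ [->|[mu Kmu <-]]] := ereal_sup_gt Knp; first by rewrite ltxx.
    by move=> h; exists mu => // muE; move: h; rewrite muE /= ltxx.
  have := Kmax _ Kmu; rewrite (energyE Kom) -/(E omega).
  rewrite ltey; apply: contraPneq => ->.
  by rewrite /= addeNy leeNy_eq => /eqP.
have Emin (nu : probability (borelC R) R) :
    (forall A, measurable A -> omega A = 0 -> nu A = 0)%E -> (E omega <= E nu)%E.
  move=> nuac.
  have nuK : prob_on K nu.
    have h : nu (~` (K : set (borelC R))) = 0%E.
      apply: nuac; first exact: measurableC.
      have -> := probability_setC omega mK.
      by rewrite (_ : omega _ = 1%E) ?subee.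
    have := probability_setC nu (measurableC mK); rewrite setCK h sube0.
    by [].
  have := Kmax _ nuK; rewrite (energyE Kom) (energyE nuK) -/(E omega) -/(E nu).
  by rewrite leeD2lE// leeN2.
exists (fine (E omega)), (K `&` [set z | \int[omega]_w log_kernel D (z, w) <= E omega]%E).
have Ef : E omega \is a fin_num by rewrite ge0_fin_numE.
have aeE := potential_le_minimal_energy_ae (@log_kernel_ge0 D) mk (@log_kernel_sym D) Emin Efin.
have mS : measurable ([set z | \int[omega]_w log_kernel D (z, w) <= E omega]%E : set (borelC R)).
  rewrite -[X in measurable X]setTI; apply: measurable_lee => //.
  by apply: (measurable_fun_fubini_tonelli_F (m2 := omega)) => // p; exact: log_kernel_ge0.
split.
- by rewrite (energyE Kom) -/(E omega) -(fineK Ef).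
- by move=> z [].
- exact: measurableI.
- exact: probability_setI1.
- by move=> z [_]; rewrite /= fineK.
Qed.

End energy.

(** * Lower bound of the potential near its carrier *)

Section near_support.
Variables (R : realType) (omega : probability (borelC R) R).
Implicit Types (x y z w h u : Cplx R).
Variables (S : set (Cplx R)) (D e0 B0 : R).
Hypotheses (mS : measurable (S : set (borelC R))) (S1 : omega (S : set (borelC R)) = 1%E).
Hypothesis SB : forall w, S w -> modulus w < B0.
Hypotheses (D0 : 0 < D) (SD : forall x y, S x -> S y -> modulus (x - y) <= D / 2).
Hypothesis Se0 : forall z, S z -> (\int[omega]_w log_kernel D (z, w) <= e0%:E)%E.

Let mk1 z : measurable_fun setT (fun w : borelC R => log_kernel D (z, w)).
Proof.
exact: (measurableT_comp (@measurable_log_kernel R D) (@measurable_pair1 _ _ (borelC R) (borelC R) z)).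
Qed.

Lemma open_disc z (r : R) : open [set w | modulus (z - w) < r].
Proof.
apply/open_modulusP => w /= wr; exists (r - modulus (z - w)); first by rewrite subr_gt0.
by move=> y wy; rewrite (le_lt_trans (modulus_triangle w _ _))// -ltrBrDl.
Qed.

(** Markov's inequality: the kernel is at least T on the disc of radius D exp(-T) about z. *)
Lemma disc_mass z (T : R) : S z -> 0 < T ->
  (omega ([set w | modulus (z - w) < D * expR (- T)]%R : set (borelC R)) * T%:E <= e0%:E)%E.
Proof.
move=> Sz T0; set A := [set w | _].
have mA : measurable (A : set (borelC R)) by apply: measurable_openC; exact: open_disc.
apply: le_trans (Se0 Sz).
rewrite muleC -(integral_cst omega mA T%:E).
apply: (@le_trans _ _ (\int[omega]_(w in (A : set (borelC R))) log_kernel D (z, w))%E).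
  apply: ge0_le_integral => //.
  - by move=> w _; rewrite lee_fin ltW.
  - exact: measurable_funTS (mk1 z).
  - move=> w Aw; rewrite /log_kernel /= le_max; apply/orP; right.
    have [->|zw] := eqVneq (z - (w : Cplx R)) 0; first by rewrite log_mod0 leey.
    have zw0 : 0 < modulus (z - (w : Cplx R)) by rewrite modulus_gt0.
    rewrite log_modE// -EFinB lee_fin.
    have : ln (modulus (z - (w : Cplx R))) <= ln (D * expR (- T)).
      by rewrite ler_ln ?posrE ?mulr_gt0 ?expR_gt0// ltW.
    by rewrite lnM ?posrE ?expR_gt0// expRK; lra.
apply: ge0_subset_integral => //.
by move=> w _; exact: log_kernel_ge0.
Qed.

Lemma e0_ge0 z : S z -> 0 <= e0.
Proof.
move=> Sz; rewrite -lee_fin; apply: le_trans (Se0 Sz).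
by apply: integral_ge0 => w _; exact: log_kernel_ge0.
Qed.

(* For z' in S nearly closest to z, |z' - w| <= 3 |z - w| on S, and the factor 3
   can be replaced by a factor close to 1 outside a small disc around z', whose
   mass is controlled by the bound on the potential at z'. *)
Lemma log_potential_near (eta : R) : 0 < eta -> exists2 d : R, 0 < d &
  forall z e z', 0 < e -> separated_by S z e -> S z' ->
    modulus (z - z') <= 2 * e -> 2 * e <= d ->
    ln D - e0 - eta <= log_potential omega S z.
Proof.
move=> eta0.
have l30 : 0 < ln (3 : R) by rewrite ln_gt0// ltr1n.
(* By [disc_mass] the disc of radius [rho] has mass at most e0 / T, so the factor 3 costs at most ln
   3 times e0 / T <= eta / 2; outside it the cost is 2 th <= eta / 2. The + 1 keeps T positive when
   e0 = 0, and e0 >= 0 is only known once a point of [S] is given. *)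
pose T := 2 * ln 3 * `|e0| / eta + 1.
have T0 : 0 < T by rewrite ltr_wpDl// divr_ge0 ?mulr_ge0// ltW.
pose rho := D * expR (- T).
have rho0 : 0 < rho by rewrite mulr_gt0 ?expR_gt0.
pose th := Num.min 2^-1 (eta / 4).
have th0 : 0 < th by rewrite lt_min; apply/andP; split; lra.
have th2 : th <= 2^-1 by rewrite ge_min lexx.
have the : th <= eta / 4 by rewrite ge_min lexx orbT.
exists (Num.min (D / 2) (th * rho)); first by rewrite lt_min; apply/andP; split; [exact: divr_gt0|exact: mulr_gt0].
move=> z e z' ez zS Sz' zz' ed.
have [eD er] : 2 * e <= D / 2 /\ 2 * e <= th * rho.
  by move: ed; rewrite le_min => /andP.
have ep := e0_ge0 Sz'.
pose A := [set w | modulus (z' - w) < rho].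
have mA : measurable (A : set (borelC R)) by apply: measurable_openC; exact: open_disc.
have pw w : S w -> ((ln D - ln (modulus (z - w)))%:E <=
    log_kernel D (z', w) + (ln 3 * \1_A w + 2 * th)%:E)%E.
  move=> Sw; have ezw := zS _ Sw.
  have zw0 : 0 < modulus (z - w) by exact: lt_le_trans ezw.
  have [z'w|z'w] := eqVneq (z' - w) 0.
    by rewrite /log_kernel /= z'w log_mod0 max_r ?leey//= leey.
  have z'w0 : 0 < modulus (z' - w) by rewrite modulus_gt0.
  apply: (@le_trans _ _ ((ln D)%:E - log_mod (z' - w) + (ln 3 * \1_A w + 2 * th)%:E)%E); last first.
    by rewrite leeD2r// /log_kernel /= le_max lexx orbT.
  rewrite log_modE// -EFinB -EFinD lee_fin.
  suff : ln (modulus (z' - w)) <= ln (modulus (z - w)) + ln 3 * \1_A w + 2 * th by lra.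
  have [Aw|Aw] := ltP (modulus (z' - w)) rho.
    rewrite indicE mem_set// mulr1 -lnM ?posrE//.
    have : ln (modulus (z' - w)) <= ln (modulus (z - w) * 3).
      rewrite ler_ln ?posrE ?mulr_gt0//.
      have := modulus_triangle z z' w; rewrite (modulusBC z' z); lra.
    by lra.
  rewrite indicE memNset ?mulr0 ?addr0; last by apply/negP; rewrite -leNgt.
  have hr : modulus (z - z') <= rho / 2.
    have : th * rho <= 2^-1 * rho by rewrite ler_pM2r.
    lra.
  have := ln_modulus_shift rho0 Aw hr; rewrite (_ : z' + (z - z') = z); last by rewrite addrC subrK.
  have : 2 * modulus (z - z') / rho <= 2 * th.
    by rewrite ler_pdivrMr// -mulrA ler_pM2l//; lra.
  by rewrite ler_norml => h /andP[]; lra.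
(* Here the diameter bound D / 2 on [S] leaves room for a point [z] off [S], so that the integrand
   ln D - ln |z - w| is nonnegative. *)
have zD w : S w -> modulus (z - w) <= D.
  move=> Sw; have := modulus_triangle z' z w; have := SD Sz' Sw; lra.
have iz := log_potential_integrable omega mS SB ez zS.
have lhs : (\int[omega]_(w in (S : set (borelC R))) (ln D - ln (modulus (z - (w : Cplx R))))%:E =
   (ln D - log_potential omega S z)%:E)%E.
  have ic : omega.-integrable (S : set (borelC R)) (EFin \o (fun=> ln D)).
    by apply: (@bounded_integrableC _ _ S mS (fun=> ln D) `|ln D|).
  rewrite -[X in (X - _)%:E](Rintegral_cstC mS S1 (ln D)) /log_potential -RintegralB//.
  rewrite /Rintegral fineK//; apply: integrable_fin_num => //.
  by have := integrableB mS ic iz; apply: eq_integrable.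
have mind : measurable_fun setT (fun w : borelC R => ln 3 * \1_A w : R).
  by apply: measurable_funM => //; exact: measurable_indic.
have key : (\int[omega]_(w in (S : set (borelC R))) (ln D - ln (modulus (z - (w : Cplx R))))%:E <=
   e0%:E + ((ln 3)%:E * omega (A : set (borelC R)) + (2 * th)%:E))%E.
  apply: (@le_trans _ _ (\int[omega]_(w in (S : set (borelC R))) (log_kernel D (z', w) + (ln 3 * \1_A w + 2 * th)%:E))%E).
    apply: ge0_le_integral => //.
    - move=> w Sw; rewrite lee_fin subr_ge0 ler_ln ?posrE ?zD//.
      by apply: lt_le_trans (zS _ Sw).
    - by apply/measurable_EFinP; apply: measurable_funB => //; apply: measurable_funTS; exact: measurable_ln_modulusB.
    - apply: emeasurable_funD; first exact: measurable_funTS (mk1 z').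
      by apply/measurable_EFinP; apply: measurable_funD => //; exact: measurable_funTS.
  rewrite ge0_integralD//; last 4 first.
  - by move=> w _; exact: log_kernel_ge0.
  - exact: measurable_funTS (mk1 z').
  - by move=> w _; rewrite lee_fin addr_ge0// mulr_ge0// ltW.
  - by apply/measurable_EFinP; apply: measurable_funD => //; exact: measurable_funTS.
  apply: leeD.
    apply: le_trans (Se0 Sz'); apply: ge0_subset_integral => //.
    by move=> w _; exact: log_kernel_ge0.
  have mth : measurable_fun setT (fun w : borelC R => (ln 3)%:E * (\1_A w : R)%:E)%E.
    by move/measurable_EFinP : mind.
  under eq_integral do rewrite EFinD EFinM.
  rewrite ge0_integralD//; last 3 first.
  - by move=> w _; rewrite mule_ge0// lee_fin ltW.
  - exact: measurable_funTS.
  - by move=> w _; rewrite lee_fin mulr_ge0// ltW.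
  rewrite ge0_integralZl_EFin//; last 2 first.
  - by apply/measurable_EFinP/measurable_funTS; exact: measurable_indic.
  - exact: ltW.
  rewrite integral_indic//; apply: leeD.
    rewrite lee_pmul2l// ?lte_fin//; apply: le_measure; rewrite ?inE//.
    exact: measurableI.
  have th20 : 0 <= 2 * th by rewrite mulr_ge0// ltW.
  rewrite integral_cst// -[leRHS]mule1 lee_wpmul2l//.
  exact: probability_le1.
have mass := disc_mass Sz' T0.
have fA : omega (A : set (borelC R)) \is a fin_num by exact: fin_num_measure.
move: key mass; rewrite lhs -/rho -/A -(fineK fA) -!EFinM -!EFinD !lee_fin.
set m := fine _ => key mass.
have mT : ln 3 * m <= eta / 2.
  have m0 : 0 <= m by rewrite fine_ge0.
  have : 2 * ln 3 * e0 / eta <= T by rewrite /T (ger0_norm ep); lra.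
  move=> hT.
  have : m * (2 * ln 3 * e0 / eta + 1) <= e0.
    by apply: le_trans mass; rewrite ler_wpM2l// /T (ger0_norm ep).
  move=> h; have [e00|e00] := eqVneq e0 0.
    have mle0 : m <= 0 by move: h; rewrite e00 mulr0 mul0r add0r mulr1.
    by have := mulr_ge0_le0 (ltW l30) mle0; lra.
  have e0p : 0 < e0 by rewrite lt_def e00.
  have : m * (2 * ln 3 * e0 / eta) <= e0 by move: h; rewrite mulrDr mulr1; lra.
  rewrite mulrA ler_pdivrMr// => h2.
  have : (ln 3 * m * 2) * e0 <= eta * e0 by move: h2; lra.
  by rewrite ler_pM2r//; lra.
lra.
Qed.

End near_support.

(** * Frostman's lower bound and strict positivity off K *)

Section frostman.
Variables (R : realType) (omega : probability (borelC R) R).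
Implicit Types (x y z w h u : Cplx R).
Variables (S : set (Cplx R)) (D e0 B0 : R).
Hypotheses (mS : measurable (S : set (borelC R))) (S1 : omega (S : set (borelC R)) = 1%E).
Hypothesis SB : forall w, S w -> modulus w < B0.
Hypotheses (D0 : 0 < D) (SD : forall x y, S x -> S y -> modulus (x - y) <= D / 2).
Hypothesis Se0 : forall z, S z -> (\int[omega]_w log_kernel D (z, w) <= e0%:E)%E.

Lemma full_measure_nonempty : S !=set0.
Proof.
apply/set0P/negP => /eqP S0; have : omega (set0 : set (borelC R)) = 1%E by rewrite -S1 S0.
by rewrite measure0 => /eqP; rewrite eq_sym onee_eq0.
Qed.

(** The distance from z to [S] need not be attained, but some point of [S] is within twice that
    distance, which is what [log_potential_near] asks for. *)
Lemma almost_nearest z e : 0 < e -> separated_by S z e ->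
  exists r w, [/\ 0 < r, separated_by S z r, S w & modulus (z - w) <= 2 * r].
Proof.
move=> ez zS; have [w0 Sw0] := full_measure_nonempty.
pose A := [set modulus (z - w) | w in S].
have Ainf : has_inf A.
  split; first by exists (modulus (z - w0)), w0.
  by exists e => _ [w Sw <-]; exact: zS.
have rA : e <= inf A by apply: lb_le_inf => [|_ [w Sw <-]]; [exact: Ainf.1|exact: zS].
have r0 : 0 < inf A by exact: lt_le_trans rA.
have [_ [w Sw <-] wr] := inf_adherent r0 Ainf.
exists (inf A), w; split => //; last lra.
by move=> u Su; apply: ge_inf; [exact: Ainf.2|exists u].
Qed.

(** At distance at least exp c from [S] the integrand is at least c, so the potential tends to
    infinity at infinity. *)
Lemma log_potential_far c z : B0 + expR c <= modulus z ->
  separated_by S z (expR c) /\ c <= log_potential omega S z.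
Proof.
move=> zc; have zS : separated_by S z (expR c).
  by move=> w /SB; have := modulusB z w; lra.
by split => //; rewrite -[leLHS]expRK (log_potential_ge mS S1 SB (expR_gt0 c) zS).
Qed.

Lemma log_potential_continuous z e : 0 < e -> separated_by S z e ->
  {for z, continuous (log_potential omega S)}.
Proof.
move=> ez zS; apply/(cvgrPdist_lt (F := nbhs z)) => d d0.
apply/nbhs_modulusP; exists (Num.min (e / 2) (d * e / 2)).
  by rewrite lt_min; apply/andP; split; [lra|rewrite divr_gt0// mulr_gt0].
move=> y; rewrite lt_min => /andP[y1 y2].
have yh : modulus (y - z) <= e / 2 by rewrite modulusBC ltW.
have := log_potential_shift mS S1 SB ez zS yh.
rewrite (_ : z + (y - z) = y); last by rewrite addrC subrK.
rewrite distrC => /le_lt_trans; apply.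
by rewrite modulusBC ltr_pdivrMr//; lra.
Qed.

(* The minimum of the potential off the closure of S would be attained; by the
   mean value property it would then be attained on an unbounded ray. *)
Lemma frostman z e : 0 < e -> separated_by S z e -> ln D - e0 <= log_potential omega S z.
Proof.
move=> ez zS; rewrite leNgt; apply/negP => vz.
pose v := log_potential omega S; pose I := ln D - e0.
pose eta := (I - v z) / 2.
have eta0 : 0 < eta by rewrite divr_gt0// subr_gt0.
have [d d0 near] := log_potential_near mS S1 SB D0 SD Se0 eta0.
pose d' := Num.min (d / 2) e.
have d'0 : 0 < d' by rewrite lt_min ez andbT divr_gt0.
(* Close to [S] the potential is at least I - eta > v z, and far out it is at least I > v z. So
   every point at positive distance from [S] with v y <= v z lies in the compact set [A], and a
   minimum over [A] is a global one. *)
pose A := [set y | modulus y <= B0 + expR I /\ separated_by S y d'].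
have inA y f : 0 < f -> separated_by S y f -> v y <= v z -> A y.
  move=> f0 yS yz; split.
    rewrite leNgt; apply/negP => /ltW/log_potential_far[_]; rewrite leNgt.
    by apply/negP; rewrite negbK; exact: le_lt_trans yz vz.
  have [r [w [r0 yr Sw yw]]] := almost_nearest f0 yS.
  have [rd|rd] := leP d' r; first by move=> u /yr; apply: le_trans.
  have : I - eta <= v y.
    by apply: near r0 yr Sw yw _; move: rd; rewrite lt_min => /andP[]; lra.
  move=> h; exfalso; move: h yz eta0; rewrite /eta; lra.
have zA : A z by apply: inA ez zS _.
have cA : compact A.
  apply: (subclosed_compact _ (@compact_disc R (B0 + expR I))); last by move=> y [].
  apply/closed_modulusP => y nAy.
  have [yb|yb] := leP (modulus y) (B0 + expR I); last first.
    exists (modulus y - (B0 + expR I)); first by rewrite subr_gt0.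
    move=> u yu [ub _]; have := modulusB y u; lra.
  have [w [Sw wd]] : exists w, S w /\ modulus (y - w) < d'.
    apply: contrapT => h; apply: nAy; split => // w Sw; rewrite leNgt; apply/negP => wd.
    by apply: h; exists w.
  exists (d' - modulus (y - w)); first by rewrite subr_gt0.
  move=> u yu [_ /(_ w Sw)]; have := modulus_triangle y u w; rewrite (modulusBC u y); lra.
have [||m mA mmin] := @compact_max R A (fun y => - v y) _ cA.
- by exists z.
- move=> y [_ yS]; apply: (@continuousN _ _ _ v); exact: log_potential_continuous d'0 yS.
have vmz : v m <= v z by have := mmin z zA; rewrite lerN2.
have vmin y f : 0 < f -> separated_by S y f -> v m <= v y.
  move=> f0 yS; have [yz|yz] := leP (v y) (v z).
    by have := mmin y (inA y f f0 yS yz); rewrite lerN2.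
  by rewrite (le_trans vmz)// ltW.
(* Each point of the ray has the minimal value, hence is again in [A] and keeps the full distance d'
   from [S], so the step d'/2 can be repeated until it leaves the bounded set [A]. *)
have ray n : A (m + ofR (n%:R * (d' / 2))) /\ v (m + ofR (n%:R * (d' / 2))) = v m.
  elim: n => [|n [[_ yS] yv]]; first by rewrite mul0r ofR0 addr0.
  set y := m + ofR (n%:R * (d' / 2)) in yS yv.
  have -> : m + ofR (n.+1%:R * (d' / 2)) = y + ofR (d' / 2).
    by rewrite -natr1 mulrDl mul1r ofRD addrA.
  have hd : modulus (ofR (d' / 2)) <= d' / 2 by rewrite modulus_ofR ger0_norm// divr_ge0// ltW.
  have d'20 : 0 < d' / 2 by rewrite divr_gt0.
  have shift := separated_by_shift yS hd.
  have E : v (y + ofR (d' / 2)) = v m.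
    rewrite -yv; apply: (log_potential_min mS S1 SB d'0 yS _ hd) => h hh.
    by rewrite -/v yv; apply: vmin d'20 (separated_by_shift yS hh).
  by split => //; apply: inA d'20 shift _; rewrite E.
have [[]] := ray (Num.trunc ((B0 + expR I + modulus m) / (d' / 2))).+1.
set n := _.+1; move=> bound _ _.
have hn : (B0 + expR I + modulus m) / (d' / 2) < n%:R by rewrite /n truncnS_gt.
have d'20 : 0 < d' / 2 by rewrite divr_gt0.
move: hn; rewrite ltr_pdivrMr// => hn.
have := modulusB (ofR (n%:R * (d' / 2))) (- m).
rewrite opprK [ofR _ + m]addrC modulusN [X in X - _]modulus_ofR ger0_norm.
  by move: bound; lra.
by rewrite mulr_ge0// ltW.
Qed.

Variable K : set (Cplx R).
Hypotheses (cK : closed K) (SK : S `<=` K) (KB : forall w, K w -> modulus w < B0).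
Hypothesis conK : connected (~` K).

(** The set where v > I contains points far out and is open by continuity. It is also relatively
    closed: a point where v = I is a minimum by [frostman], so v = I on a disc around it.
    Connectedness of the complement of K concludes. *)
Lemma frostman_pos z : ~ K z -> ln D - e0 < log_potential omega S z.
Proof.
pose v := log_potential omega S; pose I := ln D - e0.
have sepK y : ~ K y -> exists2 e, 0 < e & separated_by S y e.
  by move=> /(modulus_dist_closed cK)[e e0' h]; exists e => // w /SK/h.
apply: (@connected_clopen R (~` K) [set y | I < v y] conK).
- exists (ofR (`|B0| + expR (I + 1))).
  have m : modulus (ofR (`|B0| + expR (I + 1))) = `|B0| + expR (I + 1).
    by rewrite modulus_ofR ger0_norm// addr_ge0// ltW// expR_gt0.
  have [|_] := @log_potential_far (I + 1) (ofR (`|B0| + expR (I + 1))).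
    by rewrite m; have := ler_norm B0; lra.
  rewrite -/v => h; split; first by rewrite /=; lra.
  by move=> /KB; rewrite m; have := ler_norm B0; have := expR_gt0 (I + 1); lra.
- move=> y /sepK[e ey yS] /= Iy.
  have vc := log_potential_continuous ey yS.
  have /(cvgr_gt (F := nbhs y)) := vc; move=> /(_ I Iy)/nbhs_modulusP[d d0 h].
  by exists d => // u _; exact: h.
- move=> y /sepK[e ey yS] /= /negP; rewrite -leNgt => yI.
  have vy : v y = I by apply/le_anti; rewrite yI/=; exact: frostman ey yS.
  have e20 : 0 < e / 2 by rewrite divr_gt0.
  exists (e / 2) => // u _ yu; apply/negP; rewrite -leNgt.
  have hu : modulus (u - y) <= e / 2 by rewrite modulusBC ltW.
  have vuy : v (y + (u - y)) = v y.
    apply: (log_potential_min mS S1 SB ey yS _ hu) => h hh.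
    by rewrite -/v vy; exact: frostman e20 (separated_by_shift yS hh).
  by move: vuy; rewrite addrC subrK vy => ->.
Qed.

End frostman.

(** * Averages over roots and pole pushing *)

Section root_averages.
Variables (R : realType) (omega : probability (borelC R) R).
Implicit Types (x y z w h u : Cplx R) (f g : Cplx R -> R).
Variables (S K : set (Cplx R)) (B0 : R).
Hypotheses (mS : measurable (S : set (borelC R))) (S1 : omega (S : set (borelC R)) = 1%E).
Hypotheses (SK : S `<=` K) (cK : closed K) (KB : forall w, K w -> modulus w < B0).
Hypothesis conK : connected (~` K).

Variables (rts : nat -> seq (Cplx R)) (r : R) (N0 : nat).
Hypothesis rts_bound : forall k x, (N0 <= k)%N -> x \in rts k -> modulus x < r.
Hypothesis rts_count : forall L : set (Cplx R), closed L -> L `&` K = set0 ->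
  exists M : nat, forall k, (N0 <= k)%N -> (count (fun x => `[< L x >]) (rts k) <= M)%N.
Hypothesis rts_size : forall m, exists N, forall k, (N <= k)%N -> (m <= size (rts k))%N.

Let int f := Rintegral omega (S : set (borelC R)) (f : borelC R -> R).
Let integrable f := omega.-integrable (S : set (borelC R)) (EFin \o (f : borelC R -> R)).

Definition near_set (K : set (Cplx R)) (d : R) x : bool := `[< exists2 w, K w & modulus (x - w) < d >].

(** The divisor is the number of all roots, whatever [P], so that dropping boundedly many bounded
    terms changes little. *)
Definition root_avg (rts : nat -> seq (Cplx R)) k (P : pred (Cplx R)) f : R :=
  (size (rts k))%:R^-1 * \sum_(x <- rts k | P x) f x.

(* The averages of f over the roots near K converge to the integral of f,
   whatever small neighbourhood of K is used. *)
Definition root_avg_cvg f := integrable f /\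
  forall e : R, 0 < e -> exists2 dl : R, 0 < dl & forall d, 0 < d -> d <= dl ->
    exists N, forall k, (N <= k)%N -> `|root_avg rts k (near_set K d) f - int f| <= e.

Lemma sum_count_le (I : eqType) (s : seq I) (P : pred I) (F : I -> R) (C : R) : 0 <= C ->
  (forall i, i \in s -> P i -> `|F i| <= C) ->
  `|\sum_(i <- s | P i) F i| <= C * (count P s)%:R.
Proof.
move=> C0; elim: s => [|i s IH] h; first by rewrite big_nil normr0 mulr0.
have IH' : `|\sum_(i <- s | P i) F i| <= C * (count P s)%:R.
  by apply: IH => j js; apply: h; rewrite inE js orbT.
rewrite big_cons /= natrD mulrDr; case: ifPn => Pi; last by rewrite mulr0 add0r.
by rewrite (le_trans (ler_normD _ _))// mulr1 lerD// h// mem_head.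
Qed.

Lemma root_avg_le k (P : pred (Cplx R)) f C : 0 <= C ->
  (forall x, x \in rts k -> P x -> `|f x| <= C) -> `|root_avg rts k P f| <= C.
Proof.
move=> C0 h; rewrite /root_avg normrM ger0_norm ?invr_ge0//.
have [s0|s0] := posnP (size (rts k)).
  by rewrite s0 invr0 mul0r.
rewrite ler_pdivrMl ?ltr0n// mulrC (le_trans (sum_count_le C0 h))//.
by rewrite ler_wpM2l// ler_nat count_size.
Qed.

Lemma root_avgD k P f g :
  root_avg rts k P (fun x => f x + g x) = root_avg rts k P f + root_avg rts k P g.
Proof. by rewrite /root_avg big_split mulrDr. Qed.

Lemma root_avgZ k P c f : root_avg rts k P (fun x => c * f x) = c * root_avg rts k P f.
Proof. by rewrite /root_avg -mulr_sumr mulrCA. Qed.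

Lemma root_avg_cvgZ c f : root_avg_cvg f -> root_avg_cvg (fun x => c * f x).
Proof.
move=> [fi fc]; split; first by have := integrableZl mS c fi; apply: eq_integrable.
move=> e e0; have c0 : 0 < `|c| + 1 by rewrite ltr_wpDl.
have [dl dl0 h] := fc _ (divr_gt0 e0 c0).
exists dl => // d d0 dd; have [N hN] := h d d0 dd; exists N => k /hN hk.
rewrite root_avgZ /int RintegralZl// -mulrBr normrM.
apply: (@le_trans _ _ ((`|c| + 1) * (e / (`|c| + 1)))).
  by rewrite ler_pM// lerDl.
by rewrite mulrCA divff ?mulr1// gt_eqF.
Qed.

Lemma root_avg_cvgD f g : root_avg_cvg f -> root_avg_cvg g ->
  root_avg_cvg (fun x => f x + g x).
Proof.
move=> [fi fc] [gi gc]; split; first by have := integrableD mS fi gi; apply: eq_integrable.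
move=> e e0; have e20 : 0 < e / 2 by rewrite divr_gt0.
have [dl dl0 h] := fc _ e20; have [dl' dl'0 h'] := gc _ e20.
exists (Num.min dl dl'); first by rewrite lt_min dl0.
move=> d d0; rewrite le_min => /andP[dd dd'].
have [N hN] := h d d0 dd; have [N' hN'] := h' d d0 dd'.
exists (maxn N N') => k; rewrite geq_max => /andP[/hN hk /hN' hk'].
rewrite root_avgD /int RintegralD// opprD addrACA (le_trans (ler_normD _ _))//.
by rewrite -/(int f) -/(int g); lra.
Qed.

Lemma near_setK d w : 0 < d -> K w -> near_set K d w.
Proof. by move=> d0 Kw; apply/asboolP; exists w => //; rewrite subrr modulus0. Qed.

Lemma near_setW d d' x : d <= d' -> near_set K d x -> near_set K d' x.
Proof. by move=> dd /asboolP[w Kw wx]; apply/asboolP; exists w => //; exact: lt_le_trans dd. Qed.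

(** Approximation is only asked on a neighbourhood of K, which may shrink with the precision: the
    averages see roots near K alone, and [S] lies in K. *)
Lemma root_avg_cvg_unif f : measurable_fun (S : set (borelC R)) (f : borelC R -> R) ->
  (forall e, 0 < e -> exists g, root_avg_cvg g /\
    exists2 dl : R, 0 < dl & forall x, near_set K dl x -> `|f x - g x| <= e) ->
  root_avg_cvg f.
Proof.
move=> mf fg.
have diff g e : 0 <= e -> integrable g -> (exists2 dl : R, 0 < dl & forall x, near_set K dl x -> `|f x - g x| <= e) ->
    integrable f.
  move=> e0 gi [dl dl0 h].
  have mfg : measurable_fun (S : set (borelC R)) (fun x : borelC R => f x - g x).
    by apply: measurable_funB => //; have /integrableP[/measurable_EFinP] := gi.
  have fgi : integrable (fun x => f x - g x).
    apply: (@bounded_integrableC _ omega S mS (fun x => f x - g x) e) => // w Sw; apply: h.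
    by apply: near_setK => //; exact: SK.
  by have := integrableD mS fgi gi; apply: eq_integrable => // x _ /=; rewrite -EFinD subrK.
have fi : integrable f.
  by have [g [[gi _] gd]] := fg 1 ltr01; exact: diff ler01 gi gd.
split => // e e0; have e30 : 0 < e / 3 by rewrite divr_gt0.
have [g [[gi gc] [dl dl0 h]]] := fg _ e30.
have [dl' dl'0 h'] := gc _ e30.
exists (Num.min dl dl'); first by rewrite lt_min dl0.
move=> d d0; rewrite le_min => /andP[dd dd'].
have [N hN] := h' d d0 dd'; exists N => k /hN hk.
have a1 : `|root_avg rts k (near_set K d) (fun x => f x - g x)| <= e / 3.
  by apply: root_avg_le; [exact: ltW|move=> x _ /(near_setW dd)/h].
have a2 : `|int (fun x => f x - g x)| <= e / 3.
  apply: (Rintegral_boundC mS S1 (f := fun x => f x - g x)).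
    apply: measurable_funB => //; by have /integrableP[/measurable_EFinP] := gi.
  by move=> w /SK Kw; apply: h; exact: near_setK.
have a1' : root_avg rts k (near_set K d) (fun x => f x - g x) =
   root_avg rts k (near_set K d) f - root_avg rts k (near_set K d) g.
  by rewrite -mulN1r -root_avgZ -root_avgD; congr root_avg; apply/funext => x; rewrite mulN1r.
have a2' : int (fun x => f x - g x) = int f - int g by rewrite /int RintegralB.
move: a1 a2 hk; rewrite a1' a2' !ler_norml => /andP[? ?] /andP[? ?] /andP[? ?].
by apply/andP; split; lra.
Qed.

Lemma far_closed d : closed [set x | ~ near_set K d x].
Proof.
apply/closed_modulusP => x /= /contrapT/asboolP[w Kw wx].
exists (d - modulus (x - w)); first by rewrite subr_gt0.
move=> y xy; apply; apply/asboolP; exists w => //.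
by have := modulus_triangle x y w; rewrite (modulusBC y x); lra.
Qed.

(** The roots outside the d-neighbourhood of K lie in a closed set disjoint from K, so centering
    bounds their number by some M; their total contribution is at most C M divided by the number of
    roots. *)
Lemma root_avg_drop d (P : pred (Cplx R)) f C : 0 < d -> 0 <= C ->
  (forall x, near_set K d x -> P x) ->
  (forall x, modulus x < r -> P x -> ~~ near_set K d x -> `|f x| <= C) ->
  forall e, 0 < e -> exists N, forall k, (N <= k)%N ->
    `|root_avg rts k P f - root_avg rts k (near_set K d) f| <= e.
Proof.
move=> d0 C0 nP fC e e0.
have LK : [set x | ~ near_set K d x] `&` K = set0.
  by rewrite -subset0 => x [nx Kx]; apply: nx; exact: near_setK.
have [M hM] := rts_count (@far_closed d) LK.
have [N hN] := rts_size (Num.trunc (C * M%:R / e)).+1.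
exists (maxn N0 N) => k; rewrite geq_max => /andP[k0 /hN kN].
rewrite /root_avg -mulrBr (bigID (near_set K d)) /=.
rewrite (eq_bigl (near_set K d)); last first.
  by move=> x; case nx: near_set; rewrite ?andbF// nP.
rewrite addrAC subrr add0r normrM ger0_norm ?invr_ge0//.
have n0 : 0 < (size (rts k))%:R :> R by rewrite ltr0n (leq_trans _ kN).
rewrite ler_pdivrMl//.
apply: (@le_trans _ _ (C * M%:R)).
  apply: (le_trans (sum_count_le C0 _)).
    by move=> x xk /andP[Px nx]; apply: fC => //; exact: rts_bound xk.
  rewrite ler_wpM2l// ler_nat (leq_trans _ (hM k k0))//.
  by apply: sub_count => x /andP[_ nx]; apply/asboolP/negP.
rewrite -ler_pdivrMr//.
apply: le_trans (ltW (truncnS_gt _)) _.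
by rewrite ler_nat.
Qed.

(** [c k] will be (1/n_k) log of the modulus of the leading coefficient of q_k, plus the energy [I];
    [far_cvg] is then the regularity of q_k. *)
Variables (c : nat -> R) (r1 : R).
Hypotheses (rB : B0 <= r) (r0 : 0 < r) (rr1 : r + 1 <= r1).
Hypothesis far_cvg : forall z, r1 <= modulus z -> forall e, 0 < e ->
  exists N, forall k, (N <= k)%N ->
    `|root_avg rts k predT (fun x => ln (modulus (z - x))) + c k - log_potential omega S z| <= e.

Lemma near_separated z e x : separated_by K z e -> near_set K (e / 2) x ->
  e / 2 <= modulus (z - x).
Proof.
move=> zK /asboolP[w Kw xw]; have := zK w Kw.
by have := modulus_triangle x z w; lra.
Qed.

Lemma separated_K z : ~ K z -> exists2 e, 0 < e & separated_by K z e.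
Proof. by move=> /(modulus_dist_closed cK). Qed.

Lemma separatedS z e : separated_by K z e -> separated_by S z e.
Proof. by move=> zK w /SK/zK. Qed.

Lemma carrier_bounded w : S w -> modulus w < B0.
Proof. by move=> /SK/KB. Qed.

Lemma far_notK z : r1 <= modulus z -> ~ K z.
Proof. by move=> zr /KB; move: zr rB rr1; lra. Qed.

Lemma ln_integrable z : ~ K z -> integrable (fun x => ln (modulus (z - x))).
Proof.
move=> /separated_K[e ez zK].
exact: (log_potential_integrable omega mS carrier_bounded ez (separatedS zK)).
Qed.

Lemma far_near_cvg z d e : r1 <= modulus z -> 0 < d -> 0 < e ->
  exists N, forall k, (N <= k)%N ->
    `|root_avg rts k (near_set K d) (fun x => ln (modulus (z - x))) + c k - log_potential omega S z| <= e.
Proof.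
move=> zr d0 e0; have e20 : 0 < e / 2 by rewrite divr_gt0.
have C0 : 0 <= ln (modulus z + r).
  by rewrite ln_ge0//; move: zr rr1 r0; lra.
have [||N hN] := @root_avg_drop d predT (fun x => ln (modulus (z - x))) (ln (modulus z + r)) d0 C0 _ _ _ e20.
- by [].
- move=> x xr _ _.
  have x1 : 1 <= modulus (z - x) by have := modulusB z x; move: zr rr1 xr; lra.
  rewrite ger0_norm ?ln_ge0// ler_ln ?posrE; last 2 first.
  - exact: lt_le_trans x1.
  - by move: zr rr1 r0; lra.
  by rewrite (le_trans (modulusD _ _))// modulusN lerD2l ltW.
have [N' hN'] := far_cvg zr e20.
exists (maxn N N') => k; rewrite geq_max => /andP[/hN + /hN'].
by rewrite !ler_norml => /andP[? ?] /andP[? ?]; apply/andP; split; lra.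
Qed.

(** The difference with the far base point r1 cancels the uncontrolled [c k]. *)
Definition log_cvg z := root_avg_cvg (fun x => ln (modulus (z - x)) - ln (modulus (ofR r1 - x))).

Lemma r1_far : r1 <= modulus (ofR r1).
Proof. by rewrite modulus_ofR ler_norm. Qed.

Lemma int_ln_sub z z' : ~ K z -> ~ K z' ->
  int (fun x => ln (modulus (z - x)) - ln (modulus (z' - x))) =
  log_potential omega S z - log_potential omega S z'.
Proof. by move=> /ln_integrable ? /ln_integrable ?; rewrite /int RintegralB. Qed.

Lemma root_avgB k P f g :
  root_avg rts k P (fun x => f x - g x) = root_avg rts k P f - root_avg rts k P g.
Proof.
by rewrite -mulN1r -root_avgZ -root_avgD; congr root_avg; apply/funext => x; rewrite mulN1r.
Qed.

Lemma log_cvg_far z : r1 <= modulus z -> log_cvg z.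
Proof.
move=> zr; have zK := far_notK zr; have oK := far_notK r1_far.
split.
  by have := integrableB mS (ln_integrable zK) (ln_integrable oK); apply: eq_integrable.
move=> e e0; exists 1 => // d d0 _; have e20 : 0 < e / 2 by rewrite divr_gt0.
have [N hN] := far_near_cvg zr d0 e20; have [N' hN'] := far_near_cvg r1_far d0 e20.
exists (maxn N N') => k; rewrite geq_max => /andP[/hN + /hN'].
rewrite root_avgB int_ln_sub// !ler_norml => /andP[? ?] /andP[? ?].
by apply/andP; split; lra.
Qed.

(** Minus the term of degree i + 1 in the expansion of log |z - h - x| in powers of h. *)
Definition taylor_term z h i x : R := complex.Re ((h / (z - x)) ^+ i.+1) / i.+1%:R.

Lemma measurable_taylor_term z h i : ~ K z ->
  measurable_fun (S : set (borelC R)) (taylor_term z h i : borelC R -> R).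
Proof.
move=> zK; apply: measurable_funM => //.
apply: (@continuous_on_open_measurable _ [set x | z - x != 0] S
  (fun x => complex.Re ((h / (z - x)) ^+ i.+1))) => //.
- apply/open_modulusP => x /=; rewrite -modulus_gt0 => zx.
  exists (modulus (z - x)) => // y xy; rewrite -modulus_gt0.
  by have := modulus_triangle y z x; rewrite (modulusBC y x); lra.
- by move=> x /SK Kx; rewrite /= subr_eq0; apply: contra_notN zK => /eqP ->.
move=> x /= zx.
apply: (@continuous_comp _ _ _ (fun x => (h / (z - x)) ^+ i.+1) (@complex.Re R)); last exact: Re_continuous.
have -> : (fun x => (h / (z - x)) ^+ i.+1) = (fun y => ('X ^+ i.+1).[y]) \o (fun x => h / (z - x)).
  by apply/funext => y /=; rewrite hornerXn.
apply: continuous_comp; last exact: horner_continuous.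
apply: (@continuousM (Cplx R) _ (fun=> h) (fun x => (z - x)^-1)); first exact: cst_continuous.
apply: (@continuousV _ _ (fun x => z - x)) => //.
apply: (@continuousB _ (Cplx R) _ (fun=> z) id); [exact: cst_continuous|exact: cvg_id].
Qed.

Lemma taylor_near z e h m x : 0 < e -> separated_by K z e -> modulus h <= e / 4 ->
  near_set K (e / 2) x ->
  `|ln (modulus (z - h - x)) - ln (modulus (z - x)) + \sum_(i < m) taylor_term z h i x|
    <= 2 * (modulus h * (2 / e)) ^+ m.+1.
Proof.
move=> e0 zK he nx; have zx := near_separated zK nx.
have zx0 : 0 < modulus (z - x) by apply: lt_le_trans zx; rewrite divr_gt0.
have zxn0 : z - x != 0 by rewrite -modulus_gt0.
have y1 : modulus (h / (z - x)) <= modulus h * (2 / e).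
  rewrite modulusM modulusV ler_wpM2l ?modulus_ge0//.
  by rewrite -[leRHS]invrK invf_div lef_pV2 ?posrE ?divr_gt0.
have y2 : modulus (h / (z - x)) <= 2^-1.
  by rewrite (le_trans y1)// mulrA ler_pdivrMr//; lra.
have -> : z - h - x = (z - x) * (1 - h / (z - x)).
  by rewrite mulrBr mulr1 mulrC mulfVK// addrAC.
rewrite modulusM lnM ?posrE//; last first.
  by rewrite (lt_le_trans _ (modulus_sub1_ge y2)).
rewrite [_ + ln (modulus (1 - _))]addrC addrK.
apply: le_trans (ln_modulus_taylor m y2) _.
by rewrite ler_pM2l// lerXn2r ?nnegrE ?modulus_ge0// mulr_ge0 ?modulus_ge0// divr_ge0// ltW.
Qed.

Lemma root_avg_cvg0 : root_avg_cvg (fun=> 0).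
Proof.
split; first by apply: (@bounded_integrableC _ omega S mS (fun=> 0) 0) => // w _; rewrite normr0.
move=> e e0; exists 1 => // d _ _; exists 0%N => k _.
by rewrite /root_avg big1// mulr0 /int Rintegral_cstC// subrr normr0 ltW.
Qed.

Lemma root_avg_cvg_sum m (F : nat -> Cplx R -> R) : (forall i, (i < m)%N -> root_avg_cvg (F i)) ->
  root_avg_cvg (fun x => \sum_(i < m) F i x).
Proof.
elim: m => [|m IH] h.
  by under [X in root_avg_cvg X]eq_fun do rewrite big_ord0; exact: root_avg_cvg0.
under [X in root_avg_cvg X]eq_fun do rewrite big_ord_recr.
apply: root_avg_cvgD; last exact: h.
by apply: IH => i im; apply: h; exact: ltnW.
Qed.

Lemma root_avg_cvgB f g : root_avg_cvg f -> root_avg_cvg g ->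
  root_avg_cvg (fun x => f x - g x).
Proof.
move=> fc gc; have := root_avg_cvgD fc (root_avg_cvgZ (-1) gc).
by congr root_avg_cvg; apply/funext => x; rewrite mulN1r.
Qed.

Lemma log_cvgB z z' : log_cvg z -> log_cvg z' ->
  root_avg_cvg (fun x => ln (modulus (z - x)) - ln (modulus (z' - x))).
Proof.
move=> zc zc'; have := root_avg_cvgB zc zc'.
by congr root_avg_cvg; apply/funext => x; rewrite opprB addrA subrK.
Qed.

(* The m-th term is the limit as t -> 0 of the remainder at z - t h, divided by
   t^(m+1), after subtraction of the previous terms. *)
Lemma taylor_term_cvg z e eta h m : 0 < e -> separated_by K z e -> 0 < eta ->
  (forall y, modulus (z - y) < eta -> log_cvg y) -> root_avg_cvg (taylor_term z h m).
Proof.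
move=> e0 zK eta0 zc.
have nKz : ~ K z by move=> /zK; rewrite subrr modulus0; lra.
elim/ltn_ind: m => m IH.
apply: root_avg_cvg_unif; first exact: measurable_taylor_term.
move=> d d0.
pose H := modulus h + 1; have H0 : 0 < H by rewrite ltr_wpDl// modulus_ge0.
pose B := H * (2 / e); have B0' : 0 < B by rewrite mulr_gt0// divr_gt0.
have BB0 : 0 < 2 * B ^+ m.+2 by rewrite mulr_gt0// exprn_gt0.
(* The three bounds keep t h within the range of [taylor_near], keep z - t h where [log_cvg] is
   known, and make the remainder divided by t^(m+1), at most 2 t B^(m+2), smaller than d. *)
pose t := Num.min (Num.min (e / 4 / H) (eta / 2 / H)) (d / (2 * B ^+ m.+2)).
have t0 : 0 < t by rewrite !lt_min !divr_gt0.
have th : modulus (ofR t * h) <= t * H.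
  by rewrite modulusM modulus_ofR gtr0_norm// ler_pM2l// lerDl.
have te : t * H <= e / 4 by rewrite -ler_pdivlMr// !ge_min lexx.
have teta : t * H <= eta / 2 by rewrite -ler_pdivlMr// !ge_min lexx orbT.
have td : t * (2 * B ^+ m.+2) <= d by rewrite -ler_pdivlMr// !ge_min lexx !orbT.
have tm0 : 0 < t ^+ m.+1 by rewrite exprn_gt0.
exists (fun x => - (t ^+ m.+1)^-1 * (ln (modulus (z - ofR t * h - x)) - ln (modulus (z - x)) +
   \sum_(i < m) t ^+ i.+1 * taylor_term z h i x)); split.
  apply: root_avg_cvgZ; apply: root_avg_cvgD.
    apply: log_cvgB; apply: zc; last by rewrite subrr modulus0.
    by rewrite opprB addrC subrK (le_lt_trans th)//; lra.
  by apply: (root_avg_cvg_sum (F := fun i x => t ^+ i.+1 * taylor_term z h i x)) => i im; apply: root_avg_cvgZ; exact: IH.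
exists (e / 2); first by rewrite divr_gt0.
move=> x nx.
have he : modulus (ofR t * h) <= e / 4 by exact: le_trans te.
have := taylor_near m.+1 e0 zK he nx.
have tt i : taylor_term z (ofR t * h) i x = t ^+ i.+1 * taylor_term z h i x.
  rewrite /taylor_term -mulrA exprMn -[ofR t ^+ _]rmorphXn/= -[(t ^+ _)%:C%C]/(ofR _) Re_ofRM.
  by rewrite mulrA.
rewrite big_ord_recr /= tt.
under eq_bigr do rewrite tt.
set X := ln _ - ln _; set Y := \sum_(i < m) _ => h1.
have -> : taylor_term z h m x - - (t ^+ m.+1)^-1 * (X + Y) =
    (t ^+ m.+1)^-1 * (X + (Y + t ^+ m.+1 * taylor_term z h m x)).
  by rewrite addrA [in RHS]mulrDr mulKf ?gt_eqF// mulNr opprK [LHS]addrC.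
rewrite normrM gtr0_norm ?invr_gt0// ler_pdivrMl// (le_trans h1)//.
apply: (@le_trans _ _ (2 * (t * B) ^+ m.+2)).
  have e2 : 0 <= 2 / e by rewrite divr_ge0// ltW.
  rewrite ler_pM2l//; apply: lerXn2r; rewrite ?nnegrE.
  - by rewrite mulr_ge0// modulus_ge0.
  - by rewrite mulr_ge0// ltW.
  - by rewrite /B [leRHS]mulrA ler_wpM2r.
have -> : 2 * (t * B) ^+ m.+2 = t ^+ m.+1 * (t * (2 * B ^+ m.+2)).
  by rewrite exprMn [t ^+ m.+2]exprSr; ring.
by rewrite ler_pM2l.
Qed.

(** Convergence on an arbitrarily small disc about z gives all Taylor terms, and the Taylor series
    at z converges uniformly in x near K for every |h| <= e/4. So convergence spreads to a disc
    whose radius depends on the distance to K and not on [eta]. *)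
Lemma log_cvg_disc z e eta h : 0 < e -> separated_by K z e -> 0 < eta ->
  (forall y, modulus (z - y) < eta -> log_cvg y) -> modulus h <= e / 4 ->
  log_cvg (z - h).
Proof.
move=> e0 zK eta0 zc he.
have zcz : log_cvg z by apply: zc; rewrite subrr modulus0.
suff hc : root_avg_cvg (fun x => ln (modulus (z - h - x)) - ln (modulus (z - x))).
  have := root_avg_cvgD hc zcz.
  by congr root_avg_cvg; apply/funext => x; rewrite addrA subrK.
apply: root_avg_cvg_unif.
  by apply: measurable_funB; apply: measurable_funTS; exact: measurable_ln_modulusB.
move=> d d0.
have [N hN] := @geometric_small R 2^-1 (d / 2) ltac:(lra) ltac:(lra).
exists (fun x => -1 * \sum_(i < N) taylor_term z h i x); split.
  apply: root_avg_cvgZ; apply: root_avg_cvg_sum => i _.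
  exact: taylor_term_cvg e0 zK eta0 zc.
exists (e / 2); first by rewrite divr_gt0.
move=> x nx; rewrite mulN1r opprK (le_trans (taylor_near N e0 zK he nx))//.
have := hN N.+1 (leqnSn N).
have : (modulus h * (2 / e)) ^+ N.+1 <= 2^-1 ^+ N.+1.
  apply: lerXn2r; rewrite ?nnegrE.
  - by rewrite mulr_ge0 ?modulus_ge0// divr_ge0// ltW.
  - by [].
  - by rewrite mulrA ler_pdivrMr//; lra.
lra.
Qed.

Lemma log_cvg_compl z : ~ K z -> log_cvg z.
Proof.
move=> zK.
(* The clopen set consists of points with a whole disc of convergence, since Taylor terms are
   extracted from convergence near the centre. *)
suff : ~` K `<=` [set z | exists2 eta, 0 < eta & forall y, modulus (z - y) < eta -> log_cvg y].
  by move=> /(_ z zK)[eta eta0]; apply; rewrite subrr modulus0.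
apply: (connected_clopen conK).
- exists (ofR (r1 + 1)); split; last first.
    by apply: far_notK; rewrite modulus_ofR (le_trans _ (ler_norm _))// lerDl.
  exists 1 => // y y1; apply: log_cvg_far.
  have := modulusB (ofR (r1 + 1)) y; rewrite modulus_ofR ger0_norm; last by move: rr1 r0; lra.
  by move: y1; lra.
- move=> y _ [eta eta0 yc]; exists (eta / 2); first by rewrite divr_gt0.
  move=> u _ yu; exists (eta / 2); first by rewrite divr_gt0.
  by move=> x ux; apply: yc; have := modulus_triangle u y x; lra.
(* If a point u within e/10 of y were in the set, it would be at distance at least 9e/10 from K, and
   convergence would spread from u to radius 9e/40. This exceeds e/10 + e/10, so the disc of radius
   e/10 about y would be covered. *)
- move=> y /separated_K[e e0 yK] nyc; exists (e / 10); first by rewrite divr_gt0.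
  move=> u _ yu [eta eta0 uc]; apply: nyc; exists (e / 10); first by rewrite divr_gt0.
  move=> x yx.
  have uK : separated_by K u (9 / 10 * e).
    by move=> w /yK; have := modulus_triangle u y w; lra.
  have -> : x = u - (u - x) by rewrite opprB addrC subrK.
  apply: (log_cvg_disc _ uK eta0 uc); first lra.
  by have := modulus_triangle y u x; rewrite (modulusBC u y); lra.
Qed.

Lemma near_log_cvg z e : ~ K z -> 0 < e ->
  exists2 dl, 0 < dl & forall d, 0 < d -> d <= dl -> exists N, forall k, (N <= k)%N ->
   `|root_avg rts k (near_set K d) (fun x => ln (modulus (z - x))) + c k - log_potential omega S z| <= e.
Proof.
move=> zK e0; have e20 : 0 < e / 2 by rewrite divr_gt0.
have [_ /(_ _ e20)[dl dl0 h]] := log_cvg_compl zK.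
exists dl => // d d0 dd; have [N hN] := h d d0 dd.
have [N' hN'] := far_near_cvg r1_far d0 e20.
exists (maxn N N') => k; rewrite geq_max => /andP[/hN + /hN'].
rewrite root_avgB int_ln_sub//; last exact: far_notK r1_far.
rewrite !ler_norml => /andP[? ?] /andP[? ?].
by apply/andP; split; lra.
Qed.

(* Dropping the roots close to z, of which there are boundedly many. *)
Lemma away_log_cvg z e dz : 0 < dz -> separated_by K z dz -> 0 < e ->
  exists N, forall k, (N <= k)%N ->
   `|root_avg rts k (fun x => dz / 2 <= modulus (z - x)) (fun x => ln (modulus (z - x))) +
     c k - log_potential omega S z| <= e.
Proof.
move=> dz0 zKd e0; have e20 : 0 < e / 2 by rewrite divr_gt0.
have zK : ~ K z by move=> /zKd; rewrite subrr modulus0; lra.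
have [dl dl0 h] := near_log_cvg zK e20.
pose d := Num.min dl (dz / 2).
have d0 : 0 < d by rewrite lt_min dl0 divr_gt0.
have ddl : d <= dl by rewrite ge_min lexx.
have [N hN] := h d d0 ddl.
pose C := `|ln (dz / 2)| + `|ln (modulus z + r)|.
have [|||N' hN'] := @root_avg_drop d (fun x => dz / 2 <= modulus (z - x)) (fun x => ln (modulus (z - x))) C d0 _ _ _ _ e20.
- by rewrite addr_ge0.
- move=> x nx; apply: (near_separated zKd); apply: near_setW nx.
  by rewrite ge_min lexx orbT.
- move=> x xr zx _.
  have dz20 : 0 < dz / 2 by rewrite divr_gt0.
  (* The bound is applied with the set reduced to the single root x. *)
  apply: (@ln_modulus_bound _ [set y | modulus y < r /\ y = x] r _ z (dz / 2) x) => //.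
  + by move=> w [].
  + by move=> w [_ ->].
exists (maxn N N') => k; rewrite geq_max => /andP[/hN + /hN'].
by rewrite !ler_norml => /andP[? ?] /andP[? ?]; apply/andP; split; lra.
Qed.

End root_averages.

(** * Perturbation by constants *)

Section poly_roots.
Variable R : realType.
Implicit Types (x y z w h u : Cplx R) (p : {poly Cplx R}).

Definition poly_roots p : seq (Cplx R) := sval (closed_field_poly_normal p).

Lemma poly_rootsE p : p = lead_coef p *: \prod_(x <- poly_roots p) ('X - x%:P).
Proof. by rewrite /poly_roots; case: closed_field_poly_normal. Qed.

Lemma size_poly_roots p : p != 0 -> size (poly_roots p) = deg p.
Proof.
move=> p0; rewrite /deg {2}[p]poly_rootsE size_scale ?lead_coef_eq0//.
by rewrite size_prod_XsubC.
Qed.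

Lemma mem_poly_roots p x : p != 0 -> (x \in poly_roots p) = root p x.
Proof.
by move=> p0; rewrite {2}[p]poly_rootsE rootZ ?lead_coef_eq0// root_prod_XsubC.
Qed.

(** The multiplicity of z is its number of occurrences in [poly_roots p], so the finitely supported
    sum over L counts entries of that list. *)
Lemma nroots_inE p (L : set (Cplx R)) : p != 0 ->
  nroots_in p L = count (fun x => `[< L x >]) (poly_roots p).
Proof.
move=> p0; rewrite /nroots_in.
have mE z : mup z p = count_mem z (poly_roots p).
  rewrite {1}[p]poly_rootsE -mul_polyC mupMr ?mu_prod_XsubC//.
  by rewrite rootC lead_coef_eq0.
rewrite (fsbigE [seq x <- undup (poly_roots p) | `[< L x >]]); last 3 first.
- by rewrite filter_uniq// undup_uniq.
- by move=> x /=; rewrite mem_filter => /andP[/asboolP].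
- move=> x Lx; rewrite mem_filter mem_undup => nx; rewrite mE.
  by apply/count_memPn; move: nx; rewrite asboolT.
rewrite big_filter_cond -sum1_count -[RHS]big_undup_iterop_count.
apply: eq_big => [x|x _]; first by rewrite andb_idr// => /asboolP; rewrite inE.
rewrite mE; elim: (count _ _) => //= n IH.
by case: n IH => //= n <-.
Qed.

Lemma horner_roots p z : p.[z] = lead_coef p * \prod_(x <- poly_roots p) (z - x).
Proof.
rewrite {1}[p]poly_rootsE hornerZ horner_prod; congr (_ * _).
by apply: eq_bigr => x _; rewrite !hornerE.
Qed.

Lemma ln_modulus_horner p z : p != 0 -> ~~ root p z ->
  ln (modulus p.[z]) = ln (modulus (lead_coef p)) + \sum_(x <- poly_roots p) ln (modulus (z - x)).
Proof.
move=> p0 pz; have nz x : x \in poly_roots p -> z - x != 0.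
  by rewrite mem_poly_roots// subr_eq0; apply: contraTneq => <-.
rewrite horner_roots modulusM lnM ?posrE ?modulus_gt0 ?lead_coef_eq0//; last first.
  by rewrite prodf_seq_neq0; apply/allP => x /nz.
by congr (_ + _); have -> := @sum_ln_modulus _ _ (poly_roots p) (fun x => z - x) nz.
Qed.

Lemma deg_sub_const p (a : Cplx R) : (0 < deg p)%N -> deg (p - a%:P) = deg p.
Proof.
rewrite /deg => p0; rewrite size_polyDl// size_polyN (leq_ltn_trans (size_polyC_leq1 _))//.
by case: (size p) p0 => [|[]].
Qed.

Lemma deg_gt0_neq0 p : (0 < deg p)%N -> p != 0.
Proof. by apply: contraTneq => ->; rewrite /deg size_poly0. Qed.

End poly_roots.

(** * The Green's function off K *)

Section green_function.
Variables (R : realType) (K : set (Cplx R)) (omega : probability (borelC R) R).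
Hypotheses (cK : compact K) (npK : non_polar K) (conK : polynomially_convex K).
Hypothesis eqK : equilibrium_measure K omega.

(* S carries omega, and the Green's function is log_potential omega S - I off K. *)
Lemma green_positive : exists (S : set (Cplx R)) (I B0 : R),
  [/\ 0 < B0, [/\ measurable (S : set (borelC R)), omega (S : set (borelC R)) = 1%E,
      S `<=` K & forall w, K w -> modulus w < B0],
    forall z, ~ K z -> I < log_potential omega S z &
    forall z, ~ K z -> green omega z = (log_potential omega S z - I)%:E].
Proof.
have clK : closed K by exact: compact_modulus_closed.
have [B B00 KB] := compact_modulus_bounded cK.
have mK : measurable (K : set (borelC R)) by exact: measurable_closedC.
(* K has diameter at most 2 B, half of D, as the lower bound near the carrier requires. *)
pose D := 4 * B.
have D0 : 0 < D by rewrite mulr_gt0.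
have KD2 x y : K x -> K y -> modulus (x - y) <= D / 2.
  move=> /KB xB /KB yB; rewrite (le_trans (modulusD _ _))// modulusN /D; lra.
have KD x y : K x -> K y -> modulus (x - y) <= D.
  by move=> Kx Ky; rewrite (le_trans (KD2 _ _ Kx Ky))// ler_pdivrMr// ler_peMr// ?ler1n// ltW.
have [e [S [enE SK mS S1 SE]]] := frostman_set mK D0 KD npK eqK.
have SB w : S w -> modulus w < B by move=> /SK/KB.
have SD x y : S x -> S y -> modulus (x - y) <= D / 2.
  by move=> /SK ? /SK; exact: KD2.
exists S, (ln D - e), B; split => //.
  exact: (frostman_pos mS S1 SB D0 SD SE clK SK KB conK).
move=> z /(modulus_dist_closed clK)[d d0 zK].
have zS : separated_by S z d by move=> w /SK/zK.
by rewrite /green (potentialE mS S1 SB d0 zS) enE -EFinB.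
Qed.

End green_function.

(** * Regularity and centering of q_k - a_k *)

Section perturbation.
Variables (R : realType) (omega : probability (borelC R) R).
Implicit Types (x y z w h u : Cplx R).
Variables (S K : set (Cplx R)) (I B0 : R).
Hypotheses (B00 : 0 < B0) (mS : measurable (S : set (borelC R))).
Hypotheses (S1 : omega (S : set (borelC R)) = 1%E) (SK : S `<=` K).
Hypotheses (KB : forall w, K w -> modulus w < B0) (cK : closed K).
Hypothesis conK : connected (~` K).
Let v := log_potential omega S.
Hypothesis vpos : forall z, ~ K z -> I < v z.
Hypothesis greenE : forall z, ~ K z -> green omega z = (v z - I)%:E.

Variables (q : nat -> {poly Cplx R}) (a : nat -> Cplx R).
Hypothesis q_deg : forall k, (0 < k)%N -> (0 < deg (q k))%N.
Hypothesis q_degoo : deg (q k) @[k --> \oo] --> \oo.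
Hypothesis a_small : (fun k => logp (modulus (a k))) =o_\oo (fun k => (deg (q k))%:R : R).

Let p k := q k - (a k)%:P.

Lemma deg_large m : exists N, forall k, (N <= k)%N -> (0 < k)%N /\ (m <= deg (q k))%N.
Proof.
have /cvgnyPge/(_ m)[N _ hN] := q_degoo.
exists (maxn 1 N) => k; rewrite geq_max => /andP[k0 /hN]; split => //.
Qed.

Lemma modulus_a_small e : 0 < e -> exists N, forall k, (N <= k)%N ->
  modulus (a k) <= expR (e * (deg (q k))%:R).
Proof.
move=> e0; have /eqoP/(_ e e0)[N _ hN] := a_small.
exists N => k /hN /=; rewrite (ger0_norm (ler0n _ _)) => h.
have [->|ak0] := eqVneq (a k) 0; first by rewrite modulus0 expR_ge0.
have ma : 0 < modulus (a k) by rewrite modulus_gt0.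
rewrite -[leLHS]lnK ?posrE// ler_expR (le_trans _ h)// (le_trans _ (ler_norm _))//.
by rewrite /logp le_max lexx orbT.
Qed.

(** Regularity in real terms: finiteness of the extended distance becomes absence of roots, because
    log 0 = -oo is multiplied by a positive number. Enlarging the radius to at least B0 keeps z off
    K, where [greenE] applies. *)
Lemma regularP (f : nat -> {poly Cplx R}) :
  (forall k, (0 < k)%N -> (0 < deg (f k))%N) ->
  regular omega f <-> exists2 r, B0 <= r & forall e, 0 < e -> exists N, forall k, (N <= k)%N ->
   forall z, r <= modulus z -> ~~ root (f k) z /\
    `|(deg (f k))%:R^-1 * ln (modulus (f k).[z]) - (v z - I)| < e.
Proof.
move=> fdeg.
have notK r z : B0 <= r -> r <= modulus z -> ~ K z.
  by move=> Br rz /KB; rewrite ltNge (le_trans Br rz).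
have E k z e : (0 < k)%N -> ~ K z -> 0 < e ->
  (`|((deg (f k))%:R^-1)%:E * log_mod (f k).[z] - green omega z| < e%:E)%E <->
  ~~ root (f k) z /\ `|(deg (f k))%:R^-1 * ln (modulus (f k).[z]) - (v z - I)| < e.
  move=> k0 zK e0; rewrite greenE// /root.
  have d0 : 0 < (deg (f k))%:R^-1 :> R by rewrite invr_gt0 ltr0n fdeg.
  have [->|fz] := eqVneq (f k).[z] 0.
    by rewrite log_mod0 mulrNy gtr0_sg// mul1e /=; split => // -[].
  by rewrite log_modE// -EFinM -EFinB abse_EFin lte_fin; split => // -[].
split => [[r r0 h]|[r Br h]].
  exists (Num.max r B0); first by rewrite le_max lexx orbT.
  move=> e e0; have [N _ hN] := h e e0.
  exists (maxn 1 N) => k; rewrite geq_max => /andP[k0 /hN hk] z; rewrite ge_max => /andP[rz Bz].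
  by apply/E => //; [exact: notK Bz|exact: hk].
exists r; first exact: lt_le_trans Br.
move=> e e0; have [N hN] := h e e0.
exists (maxn 1 N) => // k /=; rewrite geq_max => /andP[k0 /hN hk] z rz.
by apply/E => //; [exact: notK Br rz|exact: hk].
Qed.

Hypothesis q_centers : centers q K.
Hypothesis q_regular : regular omega q.

Lemma potential_far_gt : exists2 r, B0 <= r & forall z, r <= modulus z -> 1 <= v z - I.
Proof.
have SB w : S w -> modulus w < B0 by move=> /SK/KB.
exists (B0 + expR (I + 1)); first by rewrite lerDl expR_ge0.
by move=> z /(log_potential_far mS S1 SB)[_]; rewrite -/v; lra.
Qed.

Lemma deg_p k : (0 < k)%N -> deg (p k) = deg (q k).
Proof. by move=> k0; apply: deg_sub_const; exact: q_deg. Qed.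

Lemma p_regular : exists2 r, B0 <= r & forall e, 0 < e -> exists N, forall k, (N <= k)%N ->
   forall z, r <= modulus z -> ~~ root (p k) z /\
    `|(deg (p k))%:R^-1 * ln (modulus (p k).[z]) - (v z - I)| < e.
Proof.
have [r1 Br1 reg] := (regularP q_deg).1 q_regular.
have [r2 Br2 far] := potential_far_gt.
exists (Num.max r1 r2); first by rewrite le_max Br1.
(* With n the degree and g >= 1, precision 1/2 gives |q_k| >= exp(n/2). Against |a_k| <= exp(n/4)
   this leaves |a_k / q_k| <= exp(-n/4) <= 1/2 once n >= 4. Then log |1 - a_k / q_k| is at most 1 in
   absolute value, and division by n >= 2/e makes it at most e/2. *)
move=> e e0; have e20 : 0 < Num.min (e / 2) 2^-1 by rewrite lt_min divr_gt0//= invr_gt0.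
have [N1 h1] := reg _ e20.
have [N2 h2] := @modulus_a_small 4^-1 ltac:(by rewrite invr_gt0).
have [N3 h3] := deg_large (maxn 4 (Num.trunc (2 / e)).+1).
exists (maxn N1 (maxn N2 N3)) => k; rewrite !geq_max => /andP[/h1 hq /andP[/h2 ha /h3[k0]]].
rewrite geq_max => /andP[n4 ne] z; rewrite ge_max => /andP[/hq[qz hz] /far gz].
rewrite deg_p//; set n : R := (deg (q k))%:R in ha hz *.
have n4' : 4 <= n by rewrite /n (ler_nat R 4).
have n0 : 0 < n by lra.
have ne' : 2 / e <= n by rewrite /n; apply: le_trans (ltW (truncnS_gt _)) _; rewrite ler_nat.
have ne1 : n^-1 <= e / 2.
  by rewrite -[leRHS]invrK invf_div lef_pV2 ?posrE// divr_gt0.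
move: hz; rewrite lt_min ltr_norml => /andP[/andP[hz1 hz2]].
rewrite ltr_norml => /andP[hz3 _].
have qz0 : (q k).[z] != 0 by [].
have mq : 0 < modulus (q k).[z] by rewrite modulus_gt0.
have lq : 2^-1 * n <= ln (modulus (q k).[z]).
  have : 2^-1 <= n^-1 * ln (modulus (q k).[z]) by lra.
  by rewrite ler_pdivlMl// mulrC.
have eq : expR (2^-1 * n) <= modulus (q k).[z] by rewrite -[leRHS]lnK ?posrE// ler_expR.
have aq : modulus (a k / (q k).[z]) <= 2^-1.
  rewrite modulusM modulusV ler_pdivrMr// (le_trans ha)//.
  apply: (@le_trans _ _ (2^-1 * expR (2^-1 * n))); last by rewrite ler_pM2l.
  have -> : 2^-1 * n = 4^-1 * n + 4^-1 * n by lra.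
  rewrite expRD mulrA ler_peMl ?expR_ge0//.
  by have := expR_ge1Dx (4^-1 * n); lra.
have pE : (p k).[z] = (q k).[z] * (1 - a k / (q k).[z]).
  by rewrite /p !hornerE mulrBr mulr1 mulrCA divff ?mulr1.
have nz : 0 < modulus (1 - a k / (q k).[z]).
  by rewrite (lt_le_trans _ (modulus_sub1_ge aq)).
have l1 : `|ln (modulus (1 - a k / (q k).[z]))| <= 1.
  by have := ln_modulus_taylor 0 aq; rewrite big_ord0 addr0 expr1 => /le_trans; apply; lra.
have pz0 : (p k).[z] != 0 by rewrite pE mulf_neq0// -modulus_gt0.
split => //; rewrite pE modulusM lnM ?posrE// mulrDr.
have l2 : `|n^-1 * ln (modulus (1 - a k / (q k).[z]))| <= e / 2.
  rewrite normrM gtr0_norm ?invr_gt0// (le_trans _ ne1)//.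
  by rewrite ler_piMr// invr_ge0 ltW.
move: l2; rewrite ler_norml ltr_norml => /andP[l2 l3].
by apply/andP; split; lra.
Qed.

Lemma p_neq0 k : (0 < k)%N -> p k != 0.
Proof. by move=> k0; apply: deg_gt0_neq0; rewrite deg_p// q_deg. Qed.

Lemma local_count z : ~ K z -> exists2 rho, 0 < rho & exists M N, forall k, (N <= k)%N ->
  (count (fun x => modulus (z - x) < rho)%R (poly_roots (p k)) <= M)%N.
Proof.
move=> zK.
have [dz dz0 zKd] := modulus_dist_closed cK zK.
have [N0 [[rc rc0 q_bound] q_count]] := q_centers.
have [rr Brr reg] := (regularP q_deg).1 q_regular.
pose N1 := maxn 1 N0.
have N1P k : (N1 <= k)%N -> (0 < k)%N /\ (N0 <= k)%N.
  by rewrite geq_max => /andP[].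
have q0 k : (0 < k)%N -> q k != 0 by move=> k0; exact: deg_gt0_neq0 (q_deg k0).
pose rts k := poly_roots (q k).
pose r := Num.max rc B0.
have rts_bound k x : (N1 <= k)%N -> x \in rts k -> modulus x < r.
  move=> /N1P[k0 kN]; rewrite mem_poly_roots ?q0// => /(q_bound k k0 kN) h.
  by rewrite lt_max h.
have rts_count L : closed L -> L `&` K = set0 ->
    exists M : nat, forall k, (N1 <= k)%N -> (count (fun x => `[< L x >]) (rts k) <= M)%N.
  move=> cL LK; have [M _ h] := q_count L cL LK; exists M => k /N1P[k0 kN].
  by rewrite -nroots_inE ?q0// h.
have rts_size m : exists N, forall k, (N <= k)%N -> (m <= size (rts k))%N.
  by have [N h] := deg_large m; exists N => k /h[k0]; rewrite size_poly_roots ?q0.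
pose c k : R := (deg (q k))%:R^-1 * ln (modulus (lead_coef (q k))) + I.
pose r1 := Num.max rr (r + 1).
have far z' : r1 <= modulus z' -> forall e, 0 < e -> exists N, forall k, (N <= k)%N ->
    `|root_avg rts k predT (fun x => ln (modulus (z' - x))) + c k - log_potential omega S z'| <= e.
  rewrite ge_max => /andP[rz' _] e e0; have [N h] := reg e e0.
  exists (maxn 1 N) => k; rewrite geq_max => /andP[k0 /h/(_ z' rz')[qz]].
  rewrite ln_modulus_horner ?q0// /root_avg size_poly_roots ?q0// /c -/v mulrDr => /ltW.
  by congr (`|_| <= _); rewrite opprB; ring.
have rB : B0 <= r by rewrite le_max lexx orbT.
have r0 : 0 < r by exact: lt_le_trans rB.
have rr1 : r + 1 <= r1 by rewrite le_max lexx orbT.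
(* The value g(z) = 4 gam is spent in quarters. The limit at z costs one, so |s(z)| >= exp(3 gam n);
   moving from z to y in the disc costs one, so |s(y)| >= exp(2 gam n). With |a_k| <= exp(gam n),
   the quotient a_k / s is at most exp(- gam n), hence finally below [eta]. *)
have gam0 : 0 < (v z - I) / 4 by rewrite divr_gt0// subr_gt0 vpos.
set gam := (v z - I) / 4 in gam0.
have vzI : v z - I = 4 * gam by rewrite /gam; lra.
have [N2 away] := away_log_cvg mS S1 SK cK KB conK rts_bound rts_count rts_size
  rB r0 rr1 far dz0 zKd gam0.
have [M hM] : exists M, forall k, (N1 <= k)%N ->
    (count (fun x => modulus (z - x) < dz / 2)%R (rts k) <= M)%N.
  have [||M hM] := rts_count [set x | modulus (z - x) <= dz / 2].
  - apply/closed_modulusP => x /negP; rewrite -ltNge => xz.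
    exists (modulus (z - x) - dz / 2); first by rewrite subr_gt0.
    by move=> y xy /=; have := modulus_triangle y z x; rewrite (modulusBC y x); lra.
  - by rewrite -subset0 => x [/= xz /zKd]; lra.
  exists M => k kN; rewrite (leq_trans _ (hM k kN))//.
  by apply: sub_count => x xz; apply/asboolP; rewrite /= ltW.
(* The roots of s are at distance at least dz/2 from z. The first bound keeps the disc off them,
   within the range of [ln_modulus_shift]; the second makes the shift of each logarithm at most 4
   tau / dz <= gam. *)
pose tau := Num.min (dz / 4) (gam * dz / 4).
have tau0 : 0 < tau by rewrite lt_min !divr_gt0// mulr_gt0.
have tau1 : tau <= dz / 4 by rewrite ge_min lexx.
have tau2 : tau <= gam * dz / 4 by rewrite ge_min lexx orbT.
pose b := Num.max 1 (tau + dz / 2).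
have b1 : 1 <= b by rewrite le_max lexx.
(* [eta] and [Nmax] depend on z, tau, b and M alone, so they are fixed before k. *)
have [eta eta0 [Nmax hcount]] := zero_count_bound z M tau0 b1.
have [N3 h3] := modulus_a_small gam0.
have [N4 h4] := @geometric_small R (expR (- gam)) eta ltac:(by rewrite expR_ge0/= expR_lt1; lra) eta0.
have [N5 h5] := deg_large N4.
exists (tau / 4); first by rewrite divr_gt0.
exists Nmax, (maxn N1 (maxn N2 (maxn N3 N5))) => k.
rewrite !geq_max => /and4P[kN1 /away hk /h3 hak /h5[k0 /h4 hg]].
pose P x := dz / 2 <= modulus (z - x).
pose lr := [seq x <- rts k | ~~ P x].
pose la := [seq x <- rts k | P x].
pose s := lead_coef (q k) *: \prod_(x <- la) ('X - x%:P).
pose zs := [seq x <- poly_roots (p k) | modulus (z - x) < tau / 4].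
pose t := lead_coef (p k) *: \prod_(x <- [seq x <- poly_roots (p k) | ~~ (modulus (z - x) < tau / 4)]) ('X - x%:P).
rewrite -size_filter -/zs.
have lc0 : lead_coef (q k) != 0 by rewrite lead_coef_eq0 q0.
have laz x y : modulus (y - z) <= tau -> x \in la -> y - x != 0.
  rewrite mem_filter => yz /andP[Px _]; rewrite -modulus_gt0.
  by move: Px; rewrite /P; have := modulus_triangle y z x; rewrite (modulusBC z y); lra.
have sE y : s.[y] = lead_coef (q k) * \prod_(x <- la) (y - x).
  by rewrite /s hornerZ horner_prod; congr (_ * _); apply: eq_bigr => x _; rewrite !hornerE.
have s0 y : modulus (y - z) <= tau -> s.[y] != 0.
  move=> yz; rewrite sE mulf_neq0// prodf_seq_neq0; apply/allP => x xla /=.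
  exact: laz yz xla.
set n : R := (deg (q k))%:R in hak.
have n0 : 0 < n by rewrite ltr0n q_deg.
have lns y : modulus (y - z) <= tau -> 2 * gam * n <= ln (modulus s.[y]).
  move=> yz; rewrite sE modulusM lnM ?posrE ?modulus_gt0//; last first.
    by rewrite prodf_seq_neq0; apply/allP => x xla /=; exact: laz yz xla.
  rewrite -(sum_ln_modulus (fun x => @laz x y yz)).
  have step x : x \in la -> ln (modulus (z - x)) - gam <= ln (modulus (y - x)).
    rewrite mem_filter => /andP[Px _].
    have := @ln_modulus_shift R z (y - z) x (dz / 2) ltac:(by rewrite divr_gt0) Px ltac:(lra).
    rewrite (_ : z + (y - z) = y); last by rewrite addrC subrK.
    have : 2 * modulus (y - z) / (dz / 2) <= gam.
      by rewrite ler_pdivrMr ?divr_gt0//; lra.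
    by rewrite ler_norml => h /andP[]; lra.
  have sumstep : \sum_(x <- la) ln (modulus (z - x)) - gam * n <= \sum_(x <- la) ln (modulus (y - x)).
    apply: (@le_trans _ _ (\sum_(x <- la) (ln (modulus (z - x)) - gam))); last first.
      by rewrite big_seq [leRHS]big_seq; apply: ler_sum.
    rewrite sumrB lerD2l lerN2 big_const_seq count_predT iter_addr_0 -mulr_natr.
    rewrite ler_wpM2l ?(ltW gam0)// ler_nat -(size_poly_roots (q0 k k0)) size_filter.
    exact: count_size.
  move: hk; rewrite /root_avg size_poly_roots ?q0// -/n -(big_filter (rts k) P) -/la.
  rewrite /c -/n -/v ler_norml => /andP[hk _].
  have : 3 * gam <= n^-1 * (\sum_(x <- la) ln (modulus (z - x)) + ln (modulus (lead_coef (q k)))).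
    by rewrite mulrDr; move: vzI hk; lra.
  rewrite ler_pdivlMl// => hk'.
  by move: sumstep hk'; lra.
apply: (hcount lr zs s t (a k)).
- by rewrite size_filter (leq_trans _ (hM k _)) ?geq_max//; apply: sub_count => x /=; rewrite /P -ltNge.
- move=> x y; rewrite mem_filter => /andP[+ _] yz; rewrite /P -ltNge => xz.
  by rewrite le_max; apply/orP; right; have := modulus_triangle z y x; lra.
- exact: s0.
- move=> y yz; rewrite (le_trans hak)//.
  have ms0 : 0 < modulus s.[y] by rewrite modulus_gt0 s0.
  apply: (@le_trans _ _ (eta * expR (2 * gam * n))); last first.
    by rewrite ler_pM2l// -[leRHS]lnK ?posrE// ler_expR lns.
  have : expR (- gam * n) <= eta.
    by rewrite expRM_natr ltW.
  move=> /(ler_wpM2r (expR_ge0 (2 * gam * n))); apply: le_trans.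
  by rewrite -expRD ler_expR; lra.
- have split (l : seq (Cplx R)) (Q : pred (Cplx R)) : \prod_(x <- l) ('X - x%:P) =
      (\prod_(x <- [seq x <- l | Q x]) ('X - x%:P)) * \prod_(x <- [seq x <- l | ~~ Q x]) ('X - x%:P).
    by rewrite !big_filter (bigID Q).
  have -> : \prod_(x <- lr) ('X - x%:P) * s = q k.
    by rewrite /s -scalerAr mulrC -split -poly_rootsE.
  by rewrite /t -scalerAl mulrC -split -poly_rootsE.
- by move=> x; rewrite mem_filter => /andP[xz _]; rewrite modulusBC ltW.
Qed.

(** By regularity the roots lie in one fixed disc, so a closed L off K may be replaced by a compact
    part of it, which finitely many discs from [local_count] cover. *)
Lemma p_centers : centers p K.
Proof.
have [rp Brp reg] := p_regular.
have [N0 h0] := reg 1 ltr01.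
have roots_bound k x : (0 < k)%N -> (N0 <= k)%N -> root (p k) x -> modulus x < rp.
  move=> k0 kN rx; rewrite ltNge; apply/negP => /(h0 k kN)[].
  by rewrite rx.
exists N0; split; first by exists rp; [exact: lt_le_trans Brp|move=> k k0 kN x; exact: roots_bound].
move=> L cL LK.
pose A := L `&` [set z | modulus z <= rp].
have cA : compact A.
  rewrite /A setIC; apply: compact_closedI => //; exact: compact_disc.
pose P (B : set (Cplx R)) := exists M N, forall k, (N <= k)%N ->
  (count (fun x => `[< B x >]) (poly_roots (p k)) <= M)%N.
have [M [N hA]] : P A.
  apply: compact_induction cA _ _ _ _.
  - exists 0%N, 0%N => k _; rewrite leqn0 -(count_pred0 (poly_roots (p k))).
    by apply/eqP/eq_count => x; apply/asboolP.
  - move=> B C [M1 [N1 h1]] [M2 [N2 h2]]; exists (M1 + M2)%N, (maxn N1 N2) => k.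
    rewrite geq_max => /andP[/h1 k1 /h2 k2]; apply: leq_trans (leq_add k1 k2).
    rewrite -count_predUI; apply: leq_trans (leq_addr _ _).
    by apply: sub_count => x /asboolP[Bx|Cx] /=; apply/orP; [left|right]; exact/asboolP.
  - move=> B C BC [M [N h]]; exists M, N => k /h; apply: leq_trans.
    by apply: sub_count => x /asboolP/BC Cx; exact/asboolP.
  - move=> z [Lz _]; have zK : ~ K z by move=> Kz; rewrite -[False]/(set0 z) -LK.
    have [rho rho0 [M [N h]]] := local_count zK; exists rho => //.
    exists M, N => k /h; apply: leq_trans.
    by apply: sub_count => x /asboolP.
(* Centering fixes its starting index before L, whereas the [N] of the covering depends on L. The
   finitely many k < N are absorbed into the bound through their degrees; the successor makes it
   positive. *)
exists (M + \sum_(k < N) deg (p k)).+1 => // k k0 kN; rewrite leqW//.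
rewrite nroots_inE ?p_neq0//.
have [kN'|kN'] := leqP N k.
  rewrite (leq_trans _ (leq_addr _ _))// (leq_trans _ (hA k kN'))//.
  rewrite -!size_filter; apply: eq_leq; congr size; apply: eq_in_filter => x.
  rewrite mem_poly_roots ?p_neq0// => /(roots_bound k x k0 kN)/ltW xr.
  by apply: asbool_equiv_eq; split => [Lx|[]].
rewrite (leq_trans (count_size _ _))// size_poly_roots ?p_neq0//.
rewrite (leq_trans _ (leq_addl _ _))// (bigD1 (Ordinal kN'))//= leq_addr//.
Qed.

End perturbation.

Theorem theorem5 (R : realType) (K : set (Cplx R))
  (omega : probability (borelC R) R)
  (q : nat -> {poly Cplx R}) (a : nat -> Cplx R) :
  compact K -> non_polar K -> polynomially_convex K ->
  equilibrium_measure K omega ->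
  (forall k, (0 < k)%N -> (0 < deg (q k))%N) ->
  deg (q k) @[k --> \oo] --> \oo ->
  (fun k => logp (modulus (a k))) =o_\oo (fun k => (deg (q k))%:R : R) ->
  centers q K -> regular omega q ->
  centers (fun k => q k - (a k)%:P) K /\
  regular omega (fun k => q k - (a k)%:P).
Proof.
move=> cK npK conK eqK q_deg q_degoo a_small q_centers q_regular.
have [S [I [B0 [B00 [mS S1 SK KB] vpos greenE]]]] := green_positive cK npK conK eqK.
have clK : closed K by exact: compact_modulus_closed.
split.
  exact: (p_centers B00 mS S1 SK KB clK conK vpos greenE q_deg q_degoo a_small q_centers q_regular).
apply/(regularP B00 KB greenE) => [k k0|].
  by rewrite deg_sub_const ?q_deg.
exact: (p_regular B00 mS S1 SK KB greenE q_deg q_degoo a_small q_regular).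
Qed.
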